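(* For any $\alpha,\beta\in(0,1)$ there exists a critical value $\rho^*_{\alpha,\beta}\in(0,\infty)$ such that, for all $\lambda,\mu>0$, the embedded queue length $(Q_n)_{n\ge0}$ of the renewal queue with parameters $\alpha,\beta,\lambda,\mu$ is transient if and only if $\lambda/\mu>\rho^*_{\alpha,\beta}$. Moreover, if $\lambda/\mu<\rho^*_{\alpha,\beta}$, then the queue length $L^{(2)}_t$ reaches an equilibrium with distribution of parameter $p=p^{\lambda,\mu}_{\alpha,\beta}$, namely $$\lim_{t\to\infty}\mathbb P\{L^{(2)}_t=j\}=\frac{1-2p}{1-p}\Big(\frac{p}{1-p}\Big)^{j},\qquad j=0,1,2,\dots$$ In the case $\lambda/\mu=\rho^*_{\alpha,\beta}$, the embedded Markov chain $(Q_n)_{n\ge0}$ is null recurrent.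
   Context: Mittag-Leffler function: $E_{a,b}(x)=\sum_{\ell\ge 0}\frac{x^{\ell}}{\Gamma(b+a\ell)}$. For $\alpha\in(0,1]$ and $\lambda>0$, a Mittag-Leffler random variable $X_{\alpha,\lambda}$ with index $\alpha$ and scale $\lambda$ is positive with $\mathbb P\{X_{\alpha,\lambda}>x\}=E_{\alpha,1}(-\lambda^{\alpha}x^{\alpha})$, $x\ge0$ (so $X_{\alpha,\lambda}$ has the law of $\lambda^{-1}X_{\alpha,1}$). Renewal queue: let $\{X^{(i)}_{\alpha,\lambda}\}_{i\ge1}$ and $\{X^{(i)}_{\beta,\mu}\}_{i\ge1}$ be two independent i.i.d. sequences of Mittag-Leffler variables. Put $Y_i=X^{(i)}_{\alpha,\lambda}\wedge X^{(i)}_{\beta,\mu}$ and let $R_t=\max\{k\ge0:\sum_{i=1}^kY_i\le t\}$ be the renewal counting process with inter-event times $Y_i$. The $i$-th renewal event is an arrival if $X^{(i)}_{\alpha,\lambda}<X^{(i)}_{\beta,\mu}$ and a departure attempt otherwise; an arrival raises the queue length by $1$, a departure attempt lowers it by $1$ if it is positive and leaves it at $0$ otherwise. Let $p^{\lambda,\mu}_{\alpha,\beta}=\mathbb P\{X_{\alpha,\lambda}<X_{\beta,\mu}\}$ (independent variables) be the arrival probability. The embedded queue length $(Q_n)_{n\ge0}$ is the queue length after the $n$-th event; it is a Markov chain on $\{0,1,2,\dots\}$ with $k\to k+1$ with probability $p^{\lambda,\mu}_{\alpha,\beta}$ and $k\to (k-1)\vee0$ with probability $1-p^{\lambda,\mu}_{\alpha,\beta}$.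 The queue length at time $t$ is $L^{(2)}_t=Q_{R_t}$. *)

(* Defs.v *)
From HB Require Import structures.
From mathcomp Require Import all_boot all_order all_algebra finmap.
From mathcomp Require Import all_classical all_reals all_analysis.

Set Implicit Arguments.
Unset Strict Implicit.
Unset Printing Implicit Defensive.

Import Order.TTheory GRing.Theory Num.Theory.
Import numFieldNormedType.Exports.

Local Open Scope classical_set_scope.
Local Open Scope ring_scope.

(* Only meaningful for x > 0, where Euler's integral converges. *)
Definition Gamma (R : realType) (x : R) : R :=
  \int[lebesgue_measure]_(t in `]0, +oo[) (t `^ (x - 1) * expR (- t)).

Definition mittag_leffler (R : realType) (a b x : R) : R :=
  limn (series (fun l : nat => x ^+ l / Gamma (b + a * l%:R))).

Definition is_mittag_leffler_RV (R : realType) (d : measure_display)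
    (T : measurableType d) (P : probability T R) (X : {RV P >-> R})
    (a l : R) : Prop :=
  {ae P, forall w, 0 < X w} /\
  (forall x : R, 0 <= x ->
     ccdf X x = (mittag_leffler a 1 (- (l `^ a * x `^ a)))%:E).

Definition mutually_independent (R : realType) (d : measure_display)
    (T : measurableType d) (P : probability T R)
    (X : nat -> {RV P >-> R}) : Prop :=
  forall (J : {fset nat}) (B : nat -> set R),
    (forall i, measurable (B i)) ->
    P (\bigcap_(i in [set` J]) (X i @^-1` B i)) =
    (\prod_(i <- J) P (X i @^-1` B i))%E.

Definition sigma_of (R : realType) (d : measure_display)
    (T : measurableType d) (P : probability T R)
    (X : nat -> {RV P >-> R}) : set (set T) :=
  <<s [set A | exists i (B : set R), measurable B /\ A = X i @^-1` B] >>.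

Definition independent_sequences (R : realType) (d : measure_display)
    (T : measurableType d) (P : probability T R)
    (X X' : nat -> {RV P >-> R}) : Prop :=
  forall A A', sigma_of X A -> sigma_of X' A' ->
    P (A `&` A') = (P A * P A')%E.

(* Sequences are indexed from 0: [X i] and [X' i] are the variables attached to
   the (i+1)-st renewal event. *)
Definition renewal_queue_input (R : realType) (d : measure_display)
    (T : measurableType d) (P : probability T R) (a b l m : R)
    (X X' : nat -> {RV P >-> R}) : Prop :=
  [/\ mutually_independent X /\ (forall i, is_mittag_leffler_RV (X i) a l),
      mutually_independent X' /\ (forall i, is_mittag_leffler_RV (X' i) b m)
    & independent_sequences X X'].

Definition event_time (R : realType) (T : Type) (X X' : nat -> T -> R)
    (k : nat) (w : T) : R :=
  \sum_(0 <= i < k) Num.min (X i w) (X' i w).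

(* For t >= 0 the maximum exists unless the event times stay below t forever,
   which has probability 0; [0] is returned in that case. *)
Definition renewal_count (R : realType) (T : Type) (X X' : nat -> T -> R)
    (t : R) (w : T) : nat :=
  xget 0%N [set k | event_time X X' k w <= t /\
                    forall j, event_time X X' j w <= t -> (j <= k)%N].

(* Queue length after n events, started from the length q0; [_.-1] on [nat]
   leaves 0 fixed. *)
Fixpoint embedded_queue (R : realType) (T : Type) (X X' : nat -> T -> R)
    (q0 n : nat) (w : T) : nat :=
  if n is n'.+1 then
    let q := embedded_queue X X' q0 n' w in
    if X n' w < X' n' w then q.+1 else q.-1
  else q0.

Definition queue_length (R : realType) (T : Type) (X X' : nat -> T -> R)
    (q0 : nat) (t : R) (w : T) : nat :=
  embedded_queue X X' q0 (renewal_count X X' t w) w.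

Definition arrival_probability (R : realType) (d : measure_display)
    (T : measurableType d) (P : probability T R)
    (X X' : nat -> {RV P >-> R}) : R :=
  fine (P [set w | X 0%N w < X' 0%N w]).

(* Below, a time-homogeneous Markov chain on [nat] is given by a realization
   from each initial state: [Q k n] is the state at time n of the chain started
   from k, so that P-probabilities of events on [Q k] are the P_k-probabilities
   of the chain. *)
Definition returns (T : Type) (Q : nat -> nat -> T -> nat) (k : nat) : set T :=
  [set w | exists n : nat, (0 < n)%N /\ Q k n w = k].

Definition return_time (R : realType) (T : Type) (Q : nat -> nat -> T -> nat)
    (k : nat) (w : T) : \bar R :=
  ereal_inf [set n%:R%:E | n in [set n : nat | (0 < n)%N /\ Q k n w = k]].

Definition transient (R : realType) (d : measure_display)
    (T : measurableType d) (P : probability T R)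
    (Q : nat -> nat -> T -> nat) : Prop :=
  forall k, (P (returns Q k) < 1)%E.

Definition null_recurrent (R : realType) (d : measure_display)
    (T : measurableType d) (P : probability T R)
    (Q : nat -> nat -> T -> nat) : Prop :=
  forall k, P (returns Q k) = 1%E /\
            (\int[P]_w return_time R Q k w)%E = +oo%E.

(* Main.v *)
Require Import Defs.
From HB Require Import structures.
From mathcomp Require Import all_boot all_order all_algebra finmap.
From mathcomp Require Import all_classical all_reals all_analysis.
From mathcomp Require Import measurable_realfun.
From mathcomp Require Import ring lra zify.

(** Everything depends on the position of the arrival probability p with respect
    to 1/2.

    Critical ratio. A Mittag-Leffler variable of scale l is a multiple, by 1/l, of
    a variable of scale 1. Hence, for one fixed pair of independent variables Y
    and Y' with indices alpha and beta, p is the probability of Y < s Y' with s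
    proportional to lambda / mu ([prob_arrival_scale]). This probability tends to
    0 at s = 0 and to 1 at infinity because Y and Y' are positive; it is
    continuous because the law of Y has no atom, the Mittag-Leffler function being
    continuous; and it is strictly increasing because both laws have mass in every
    interval close to 0, the Mittag-Leffler function having the derivative
    1 / Gamma (1 + alpha) > 0 at 0. So it equals 1/2 at exactly one point
    ([threshold], [critical_ratio]). The properties of the Mittag-Leffler function
    come from the estimate Gamma x >= M^(x-1) e^(-(M+1)), valid for all x >= 1 and
    M > 0, which makes its power series entire ([Gamma_inv_le]).

    Embedded chain. The indicators of the arrivals are independent tosses of a
    coin of parameter p, so that events decided by n tosses have the probability
    [toss_prob] ([prob_arrivals]). The return probabilities and the expected
    return times are then read off from the one-step equations of the hitting
    probabilities of a nearest-neighbour walk: their solutions are combinations of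
    1 and of the powers of (1 - p) / p, or affine when p = 1/2, and the bounds 0
    and 1 select one of them ([hit_ever1], [hit_ever_geom]). The expected return
    times at p = 1/2 are infinite by [sum_survival_unbounded].

    Equilibrium. The queue length at time t is Q_n for n = R_t, and R_t is not
    independent of the chain, because the duration of a step and its outcome come
    from the same pair. Time reversal removes this difficulty. The pairs of
    variables are i.i.d., hence exchangeable ([prob_path_reversal]), and the event
    R_t = n is invariant under the reversal of the first n pairs; this reversal
    turns Q_n into the backward composition W_n of the same random maps
    ([prob_last_event_reversal]). Thus Q at R_t has the law of W at R_t. When
    p < 1/2, almost surely W_n is eventually constant ([prob_uncoalesced_after],
    [queue_bwd_stable]) while R_t is finite ([prob_no_last_event]) and tends to
    infinity ([prob_event_time_gt]); so W at R_t converges to the limit of W_n.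
    The limit is at least j exactly when a walk of negative drift ever reaches the
    level j, which has the probability (p / (1 - p))^j ([toss_prob_queue_bwd]). *)

Set Implicit Arguments.
Unset Strict Implicit.
Unset Printing Implicit Defensive.

Import Order.TTheory GRing.Theory Num.Theory.
Import numFieldNormedType.Exports.

Local Open Scope classical_set_scope.
Local Open Scope ring_scope.

(** * Probabilities of events decided by finitely many coin tosses *)
Section CoinTossing.
Variable R : realType.

(** The probability that n independent tosses, each [true] with probability p,
    form a list in A. Conditioning on the first toss makes it computable by
    recursion, so that every fact about the embedded chain up to time n becomes
    an identity between real numbers. *)
Fixpoint toss_prob (p : R) (n : nat) (A : pred (seq bool)) : R :=
  if n is n'.+1 then
    p * toss_prob p n' (fun e => A (true :: e)) +
    (1 - p) * toss_prob p n' (fun e => A (false :: e))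
  else (A [::])%:R.

Lemma eq_toss_prob p n (A B : pred (seq bool)) :
  (forall e, size e = n -> A e = B e) -> toss_prob p n A = toss_prob p n B.
Proof.
elim: n A B => [|n IH] A B AB /=; first by rewrite AB.
by congr (_ * _ + _ * _); apply: IH => e en; rewrite AB//= en.
Qed.

Lemma toss_prob_true p n : toss_prob p n predT = 1.
Proof.
elim: n => // n IH.
have -> : toss_prob p n.+1 predT = p * toss_prob p n predT + (1 - p) * toss_prob p n predT by [].
by rewrite IH; ring.
Qed.

Lemma toss_prob_ge0 p n A : 0 <= p <= 1 -> 0 <= toss_prob p n A.
Proof.
move=> p01; elim: n A => [|n IH] A //=.
by rewrite addr_ge0// mulr_ge0//; lra.
Qed.

(** Chernoff's method: the indicator of A is bounded by c times a product of
    independent factors, whose expectations multiply. *)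
Lemma toss_prob_le_genfun p a b c n (A : pred (seq bool)) :
  0 <= p <= 1 -> 0 <= a -> 0 <= b -> 0 <= c ->
  (forall e, size e = n -> A e -> 1 <= c * \prod_(x <- e) (if x then a else b)) ->
  toss_prob p n A <= c * (p * a + (1 - p) * b) ^+ n.
Proof.
move=> p01 a0 b0; elim: n A c => [|n IH] A c c0 AP /=.
  rewrite expr0 mulr1; case A0: (A [::]) => //=; have := AP [::] erefl A0.
  by rewrite big_nil mulr1.
have Pt : toss_prob p n (fun e => A (true :: e)) <=
    (c * a) * (p * a + (1 - p) * b) ^+ n.
  apply: IH => [|e en Ae]; first exact: mulr_ge0.
  by have := AP (true :: e); rewrite /= en big_cons mulrA => /(_ erefl Ae).
have Pf : toss_prob p n (fun e => A (false :: e)) <=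
    (c * b) * (p * a + (1 - p) * b) ^+ n.
  apply: IH => [|e en Ae]; first exact: mulr_ge0.
  by have := AP (false :: e); rewrite /= en big_cons mulrA => /(_ erefl Ae).
have p0 : 0 <= p by lra.
have q0 : 0 <= 1 - p by lra.
apply: le_trans (lerD (ler_wpM2l p0 Pt) (ler_wpM2l q0 Pf)) _.
by rewrite exprS le_eqVlt; apply/orP; left; apply/eqP; ring.
Qed.

Lemma toss_probD p n (A B C : pred (seq bool)) :
  (forall e, A e = (B e + C e)%N :> nat) ->
  toss_prob p n A = toss_prob p n B + toss_prob p n C.
Proof.
elim: n A B C => [|n IH] A B C ABC /=; first by rewrite ABC natrD.
rewrite (IH (fun e => A (true :: e)) (fun e => B (true :: e)) (fun e => C (true :: e)))//.
rewrite (IH (fun e => A (false :: e)) (fun e => B (false :: e)) (fun e => C (false :: e)))//.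
by ring.
Qed.

Lemma toss_prob_mono p n (A B : pred (seq bool)) : 0 <= p <= 1 ->
  (forall e, size e = n -> A e -> B e) -> toss_prob p n A <= toss_prob p n B.
Proof.
move=> p01; have [p0 q0] : 0 <= p /\ 0 <= 1 - p by lra.
elim: n A B => [|n IH] A B AB /=.
  by rewrite ler_nat; case: (A [::]) (AB [::] erefl) => // ->.
by apply: lerD; apply: ler_wpM2l => //; apply: IH => e en; apply: AB; rewrite /= en.
Qed.

(** * Hitting probabilities of the nearest-neighbour walk *)

(** The probability that the walk on the integers that steps up with
    probability r, started from k, visits 0 within n steps. *)
Fixpoint hit_prob (r : R) (n k : nat) : R :=
  match k, n with
  | 0%N, _ => 1
  | k'.+1, 0%N => 0
  | k'.+1, n'.+1 => r * hit_prob r n' k'.+2 + (1 - r) * hit_prob r n' k'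
  end.

Lemma hit_prob0 r n : hit_prob r n 0 = 1.
Proof. by case: n. Qed.

Lemma hit_prob_ge0 r n k : 0 <= r <= 1 -> 0 <= hit_prob r n k.
Proof.
move=> r01; elim: n k => [|n IH] [|k] //=.
by rewrite addr_ge0// mulr_ge0//; lra.
Qed.

Lemma hit_prob_le1 r n k : 0 <= r <= 1 -> hit_prob r n k <= 1.
Proof.
move=> r01; elim: n k => [|n IH] [|k] //=.
have := IH k.+2; have := IH k => *; nra.
Qed.

Lemma hit_prob_leS r n k : 0 <= r <= 1 -> hit_prob r n k <= hit_prob r n.+1 k.
Proof.
move=> r01; have [r0 q0] : 0 <= r /\ 0 <= 1 - r by lra.
elim: n k => [|n IH] [|k] //.
  exact: (hit_prob_ge0 1 k.+1 r01).
exact: lerD (ler_wpM2l r0 (IH k.+2)) (ler_wpM2l q0 (IH k)).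
Qed.

(** The hitting probability is the smallest nonnegative solution of its one-step
    equation, and the powers of (1 - r) / r form another solution. *)
Lemma hit_prob_le_geom r n k : 0 < r <= 1 -> hit_prob r n k <= ((1 - r) / r) ^+ k.
Proof.
move=> r01; have s0 : 0 <= (1 - r) / r by rewrite divr_ge0//; lra.
elim: n k => [|n IH] [|k] //=; first by rewrite exprn_ge0.
have r0 : 0 <= r by lra.
have q0 : 0 <= 1 - r by lra.
apply: le_trans (lerD (ler_wpM2l r0 (IH k.+2)) (ler_wpM2l q0 (IH k))) _.
rewrite le_eqVlt; apply/orP; left; apply/eqP; rewrite !exprS.
by field; lra.
Qed.

Lemma nondecreasing_hit_prob r k : 0 <= r <= 1 ->
  nondecreasing_seq (fun n => hit_prob r n k).
Proof. by move=> r01; apply/nondecreasing_seqP => n; exact: hit_prob_leS. Qed.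

(** The probability of ever visiting 0, as the limit of the nondecreasing
    sequence of the hitting probabilities within n steps. *)
Definition hit_ever (r : R) (k : nat) : R := limn (fun n => hit_prob r n k).

Lemma cvg_hit_ever r k : 0 <= r <= 1 -> hit_prob r n k @[n --> \oo] --> hit_ever r k.
Proof.
move=> r01; apply: nondecreasing_is_cvgn; first exact: nondecreasing_hit_prob.
by exists 1 => _ [n _ <-]; exact: hit_prob_le1.
Qed.

Lemma hit_ever0 r : 0 <= r <= 1 -> hit_ever r 0 = 1.
Proof.
by move=> r01; apply/cvg_lim => //; under eq_fun do rewrite hit_prob0; exact: cvg_cst.
Qed.

Lemma hit_ever_ge0 r k : 0 <= r <= 1 -> 0 <= hit_ever r k.
Proof.
move=> r01; apply: limr_ge; first exact/cvgP/cvg_hit_ever.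
by near=> n; exact: hit_prob_ge0.
Unshelve. all: by end_near. Qed.

Lemma hit_everS r k : 0 <= r <= 1 ->
  hit_ever r k.+1 = r * hit_ever r k.+2 + (1 - r) * hit_ever r k.
Proof.
move=> r01; apply/cvg_lim => //; rewrite -(cvg_shiftS _)/=.
by apply: cvgD; apply: cvgMr; exact: cvg_hit_ever.
Qed.

(** The decrements d k of [hit_ever] satisfy r d (k+1) = (1 - r) d k, so for
    r <= 1/2 they do not decrease; a positive first one would make
    [hit_ever] negative far away. *)
Lemma hit_ever1 r k : 0 <= r <= 1 / 2 -> hit_ever r k = 1.
Proof.
move=> r12; have r01 : 0 <= r <= 1 by lra.
have h0 := hit_ever0 r01; have hS i := hit_everS i r01.
have hge i := hit_ever_ge0 i r01.
pose d i := hit_ever r i - hit_ever r i.+1.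
have rd i : r * d i.+1 = (1 - r) * d i by rewrite /d; have := hS i; lra.
have hle i : hit_ever r i <= 1.
  by apply: limr_le; [exact/cvgP/cvg_hit_ever|near=> n; exact: hit_prob_le1].
have d0 : 0 <= d 0%N by rewrite /d h0 subr_ge0.
have [r0|r0] : r = 0 \/ 0 < r by have [->|] := eqVneq r 0; [left|right; lra].
  elim: k => // k; have := hS k; rewrite r0; lra.
have dS i : 0 <= d i -> d i <= d i.+1.
  by move=> di; have := rd i => rdi; rewrite -(ler_pM2l r0) rdi ler_wpM2r//; lra.
have dge i : d 0%N <= d i.
  by elim: i => // i IH; apply: (le_trans IH); apply: dS; exact: le_trans IH.
have hlin i : hit_ever r i <= 1 - i%:R * d 0%N.
  elim: i => [|i IH]; first by rewrite h0 mul0r subr0.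
  by have := dge i; rewrite -natr1 {2}/d; lra.
have d00 : d 0%N = 0.
  apply/eqP; rewrite eq_le d0 andbT leNgt; apply/negP => dp.
  have := hlin (Num.bound (d 0%N)^-1); have := hge (Num.bound (d 0%N)^-1).
  have : 1 < (Num.bound (d 0%N)^-1)%:R * d 0%N.
    by rewrite -ltr_pdivrMr// div1r archi_boundP// invr_ge0.
  by lra.
have di0 i : d i = 0.
  elim: i => // i IH; have := rd i; rewrite IH mulr0 => /eqP.
  by rewrite mulf_eq0 gt_eqF//= => /eqP.
elim: k => // k; have := di0 k; rewrite /d; lra.
Unshelve. all: by end_near. Qed.

(** For r > 1/2 the decrements are geometric, which leaves one free constant;
    it is fixed by the value 1 at 0 and the limit 0 at infinity, the latter
    coming from [hit_prob_le_geom]. *)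
Lemma hit_ever_geom r k : 1 / 2 < r <= 1 -> hit_ever r k = ((1 - r) / r) ^+ k.
Proof.
move=> r12; have r01 : 0 <= r <= 1 by lra.
have r01' : 0 < r <= 1 by lra.
have h0 := hit_ever0 r01; have hS i := hit_everS i r01.
have hge i := hit_ever_ge0 i r01.
set s := (1 - r) / r.
have s0 : 0 <= s by rewrite divr_ge0//; lra.
have s1 : s < 1 by rewrite ltr_pdivrMr; lra.
have hle i : hit_ever r i <= s ^+ i.
  apply: limr_le; first exact/cvgP/cvg_hit_ever.
  by near=> n; exact: hit_prob_le_geom.
pose d i := hit_ever r i - hit_ever r i.+1.
have dS i : d i.+1 = s * d i.
  apply: (@mulfI _ r); first by rewrite gt_eqF; lra.
  rewrite mulrA /s [X in _ = X * _]mulrC divfK; last by rewrite gt_eqF; lra.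
  by rewrite /d; have := hS i; lra.
have dE i : d i = s ^+ i * d 0%N.
  by elim: i => [|i IH]; rewrite ?expr0 ?mul1r// dS IH exprS mulrA.
have hE i : (1 - s) * (1 - hit_ever r i) = (1 - s ^+ i) * d 0%N.
  elim: i => [|i IH]; first by rewrite h0 expr0; ring.
  rewrite exprS; have := dE i; rewrite {1}/d => dEi.
  have -> : hit_ever r i.+1 = hit_ever r i - s ^+ i * d 0%N by lra.
  transitivity ((1 - s) * (1 - hit_ever r i) + (1 - s) * (s ^+ i * d 0%N)); first by ring.
  by rewrite IH; ring.
have cs : s ^+ i @[i --> \oo] --> (0 : R).
  by apply: cvg_expr; rewrite ger0_norm.
have ch : hit_ever r i @[i --> \oo] --> (0 : R).
  apply: (@squeeze_cvgr _ _ _ _ (fun=> 0) (fun i => s ^+ i)) => //.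
    by near=> i; rewrite hge hle.
  exact: cvg_cst.
have d0 : d 0%N = 1 - s.
  have l1 : (1 - s) * (1 - hit_ever r i) @[i --> \oo] --> (1 - s) * (1 - 0).
    by apply: cvgMr; apply: cvgB => //; exact: cvg_cst.
  have l2 : (1 - s ^+ i) * d 0%N @[i --> \oo] --> (1 - 0) * d 0%N.
    by apply: cvgMl; apply: cvgB => //; exact: cvg_cst.
  rewrite (_ : (fun i => (1 - s ^+ i) * d 0%N) = (fun i => (1 - s) * (1 - hit_ever r i))) in l2.
    by have := cvg_unique _ l1 l2; rewrite subr0 mulr1 mul1r => ->.
  by apply/funext => i; rewrite hE.
have := hE k; rewrite d0 mulrC => /mulIf -/(_ _); rewrite subr_eq0 gt_eqF// => /(_ isT).
by lra.
Unshelve. all: by end_near. Qed.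

(** The symmetric walk takes an infinite expected time to reach 0 from 1: the sum
    is the expectation of the hitting time truncated at n. If these expectations
    had finite limits l k, then l would have constant second difference -2,
    hence l k = k (l 1 - k + 1), which is negative for large k. *)
Lemma sum_survival_unbounded (C : R) :
  exists n, C <= \sum_(i < n) (1 - hit_prob (1 / 2) i 1).
Proof.
have h01 : 0 <= (1 / 2 : R) <= 1 by lra.
apply: contrapT => /forallNP nC.
pose m n k : R := \sum_(i < n) (1 - hit_prob (1 / 2) i k).
have mC n : m n 1%N <= C by apply/ltW; rewrite ltNge; apply/negP; exact: nC.
have s0 i k : 0 <= 1 - hit_prob (1 / 2 : R) i k by rewrite subr_ge0 hit_prob_le1.
have m0 n : m n 0%N = 0 by rewrite /m big1// => i _; rewrite hit_prob0 subrr.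
have mge n k : 0 <= m n k by rewrite /m sumr_ge0.
have mS n k : m n.+1 k.+1 = 1 + 1 / 2 * m n k.+2 + 1 / 2 * m n k.
  rewrite /m big_ord_recl /= subr0 -addrA; congr (_ + _).
  rewrite !mulr_sumr -big_split/=; apply: eq_bigr => i _.
  by rewrite /=; lra.
have mleS n k : m n k <= m n.+1 k by rewrite /m big_ord_recr/= lerDl.
have bd k : exists B, forall n, m n k <= B.
  elim: k => [|[|k] [B HB]]; first by exists 0 => n; rewrite m0.
    by exists C.
  exists (2 * B) => n; have := HB n.+1; rewrite mS.
  by have := mge n k; lra.
pose l k : R := limn (m ^~ k).
have cl k : m n k @[n --> \oo] --> l k.
  have [B HB] := bd k.
  apply: nondecreasing_is_cvgn; first exact/nondecreasing_seqP.
  by exists B => _ [n _ <-].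
have l0 : l 0%N = 0.
  by apply/cvg_lim => //; rewrite (funext m0); exact: cvg_cst.
have lS k : l k.+1 = 1 + 1 / 2 * l k.+2 + 1 / 2 * l k.
  apply/cvg_lim => //; rewrite -(cvg_shiftS _)/= (funext (mS ^~ k)).
  apply: cvgD; last by apply: cvgMr; exact: cl.
  by apply: cvgD; [exact: cvg_cst|apply: cvgMr; exact: cl].
have lE k : l k = k%:R * l 1%N - k%:R * (k%:R - 1) /\
            l k.+1 = k.+1%:R * l 1%N - k.+1%:R * k%:R.
  elim: k => [|k [IH1 IH2]]; first by rewrite l0; split; lra.
  split; first by rewrite IH2 -natr1; ring.
  have -> : l k.+2 = 2 * l k.+1 - 2 - l k by have := lS k; lra.
  by rewrite IH1 IH2 -(natr1 k.+1) -(natr1 k); ring.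
have lge k : 0 <= l k.
  by apply: limr_ge; [exact: cvgP (cl k)|near=> n; exact: mge].
have lk k : k%:R <= l 1%N.
  by have := lge k.+1; rewrite (lE k).2 -mulrBr pmulr_rge0 ?ltr0n// subr_ge0.
have := lk (Num.bound (l 1%N)); rewrite leNgt => /negP; apply.
exact: archi_boundP.
Unshelve. all: by end_near. Qed.


(** * The reflected walk, run forward and backward *)

Definition queue_step (b : bool) (q : nat) : nat := if b then q.+1 else q.-1.

Definition queue_fwd (q : nat) (e : seq bool) : nat :=
  foldl (fun q b => queue_step b q) q e.

(** The same tosses composed in the opposite order: a new toss acts first, on the
    initial length, instead of last. The two compositions have the same law for
    a fixed number of tosses, but the backward one converges pathwise. *)
Definition queue_bwd (q : nat) (e : seq bool) : nat := foldr queue_step q e.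

Lemma queue_fwd_rev q e : queue_fwd q (rev e) = queue_bwd q e.
Proof. by rewrite /queue_fwd foldl_rev. Qed.

Lemma queue_bwd_mono e : {homo queue_bwd ^~ e : q q' / (q <= q')%N}.
Proof. by move=> q q' qq'; elim: e => //= -[] e /=; rewrite /queue_step; lia. Qed.

(** Prepending a toss moves the backward queue up or down, so that reaching
    the level j amounts to a walk hitting 0 from j; an arrival brings the walk
    closer to 0, whence the parameter 1 - p. *)
Lemma toss_prob_queue_bwd p n j :
  toss_prob p n (fun e => j <= queue_bwd 0 e)%N = hit_prob (1 - p) n j.
Proof.
elim: n j => [|n IH] [|j] //.
  by rewrite hit_prob0 -[RHS](toss_prob_true p n.+1); apply: eq_toss_prob.
rewrite /= opprB [1 + (p - 1)]addrC subrK -!IH [RHS]addrC.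
by congr (_ * _ + _ * _); apply: eq_toss_prob => e _ /=; rewrite /queue_bwd; lia.
Qed.

Lemma toss_prob_queue_bwd_eq p n j :
  toss_prob p n (fun e => queue_bwd 0 e == j) =
  hit_prob (1 - p) n j - hit_prob (1 - p) n j.+1.
Proof.
rewrite -!toss_prob_queue_bwd; apply/eqP; rewrite eq_sym subr_eq; apply/eqP.
by apply: toss_probD => e; case: ltngtP.
Qed.

(** The backward queues started from q and from 0 agree as soon as the net number
    of departures exceeds q, that is, unless the product on the right, which is
    a to the power q + arrivals - departures, is at least 1. *)
Lemma queue_bwd_coalesce (a : R) q e : 1 <= a -> queue_bwd q e != queue_bwd 0 e ->
  1 <= a ^+ q * \prod_(x <- e) (if x then a else a^-1).
Proof.
move=> a1; have a0 : a != 0 by lra.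
elim/last_ind: e q => [|e b IH] q.
  by rewrite big_nil mulr1 => _; rewrite exprn_ege1.
rewrite -cats1 /queue_bwd !foldr_cat /= -!/(queue_bwd _ _) big_cat big_seq1 /=.
case: b => /= [neq|neq].
  rewrite mulrA mulrAC -exprSr; apply: IH; apply: contra neq => /eqP qE.
  have le1 : (queue_bwd 1 e <= queue_bwd q.+1 e)%N by exact: queue_bwd_mono.
  have le2 : (queue_bwd 0 e <= queue_bwd 1 e)%N by exact: queue_bwd_mono.
  by apply/eqP/anti_leq; rewrite [X in _ && X]le1 andbT; move: le2; rewrite -qE.
case: q neq => [|q] /= neq; first by rewrite eqxx in neq.
by rewrite exprSr mulrA mulrAC mulfK//; exact: IH.
Qed.

Fixpoint visits (k q : nat) (e : seq bool) : bool :=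
  (q == k) || (if e is b :: e' then visits k (queue_step b q) e' else false).

Definition comes_back (k : nat) (e : seq bool) : bool :=
  if e is b :: e' then visits k (queue_step b k) e' else false.

(** Above k the reflected walk does not feel the barrier until it visits k. *)
Lemma toss_prob_visits p n k i :
  toss_prob p n (visits k (k + i)) = hit_prob p n i.
Proof.
elim: n i => [|n IH] [|i].
- by rewrite /= addn0 eqxx.
- by rewrite /= orbF -[X in _ == X]addn0 eqn_add2l.
- rewrite hit_prob0 -[RHS](toss_prob_true p n.+1); apply: eq_toss_prob.
  by case=> [|b e] _ /=; rewrite addn0 eqxx.
rewrite /= -!IH; congr (_ * _ + _ * _); apply: eq_toss_prob => e _ /=.
  by rewrite -[X in _ == X]addn0 eqn_add2l /= !addnS.
by rewrite -[X in _ == X]addn0 eqn_add2l /= addnS.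
Qed.

Lemma toss_prob_comes_backS p n k :
  toss_prob p n.+1 (comes_back k) =
  p * hit_prob p n 1 + (1 - p) * toss_prob p n (visits k k.-1).
Proof. by rewrite /= -addn1 toss_prob_visits. Qed.

(** After a step up the walk hits k again with probability at most (1 - p) / p,
    and after a step down with probability at most 1: p (1 - p) / p + 1 - p. *)
Lemma toss_prob_comes_back_transient p n k : 1 / 2 < p <= 1 ->
  toss_prob p n (comes_back k) <= 2 * (1 - p).
Proof.
move=> p12; have p01 : 0 <= p <= 1 by lra.
have p01' : 0 < p <= 1 by lra.
case: n => [|n]; first by rewrite /=; lra.
rewrite toss_prob_comes_backS.
have := hit_prob_le_geom n 1 p01'; rewrite expr1 ler_pdivlMr; last by lra.
have : toss_prob p n (visits k k.-1) <= 1.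
  by rewrite -(toss_prob_true p n) toss_prob_mono.
have q0 : 0 <= 1 - p by lra.
by move=> /(ler_wpM2l q0); lra.
Qed.

Lemma toss_prob_visits_leS p n k q : 0 <= p <= 1 ->
  toss_prob p n (visits k q) <= toss_prob p n.+1 (visits k q).
Proof.
move=> p01; have [p0 q0] : 0 <= p /\ 0 <= 1 - p by lra.
have E1 m : toss_prob p m (visits k k) = 1.
  rewrite -[RHS](toss_prob_true p m).
  by apply: eq_toss_prob => -[|b e] _; rewrite /= eqxx.
have [->|] := eqVneq q k; first by rewrite !E1.
elim: n q => [|n IH] q /negPf qk.
  by rewrite [leLHS]/= qk; exact: toss_prob_ge0.
have E m : toss_prob p m.+1 (visits k q) =
    p * toss_prob p m (visits k q.+1) + (1 - p) * toss_prob p m (visits k q.-1).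
  by rewrite /= qk.
have IH' i : toss_prob p n (visits k i) <= toss_prob p n.+1 (visits k i).
  have [->|] := eqVneq i k; last exact: IH.
  by rewrite !E1.
by rewrite !E lerD ?ler_wpM2l.
Qed.

(** Below k the limiting probabilities of visiting k are harmonic; reflection at 0
    makes the first increment vanish, hence all of them up to k. *)
Lemma cvg_toss_prob_visits_below k q : (q <= k)%N ->
  toss_prob (1 / 2) n (visits k q) @[n --> \oo] --> (1 : R).
Proof.
have h01 : 0 <= (1 / 2 : R) <= 1 by lra.
pose u n q := toss_prob (1 / 2 : R) n (visits k q).
pose l q : R := limn (u ^~ q).
have cl i : u n i @[n --> \oo] --> l i.
  apply: nondecreasing_is_cvgn.
    by apply/nondecreasing_seqP => n; exact: toss_prob_visits_leS.
  exists 1 => _ [n _ <-].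
  by rewrite -(toss_prob_true (1 / 2) n) toss_prob_mono.
have lk : l k = 1.
  apply/cvg_lim => //; rewrite (_ : u ^~ k = fun=> 1); first exact: cvg_cst.
  apply/funext => n; rewrite -[RHS](toss_prob_true (1 / 2) n).
  by apply: eq_toss_prob => -[|b e] _; rewrite /= eqxx.
have lS i : (i < k)%N -> l i = 1 / 2 * l i.+1 + 1 / 2 * l i.-1.
  move=> ik; apply/cvg_lim => //; rewrite -(cvg_shiftS _)/=.
  rewrite (_ : (fun n => u n.+1 i) = (fun n => 1 / 2 * u n i.+1 + 1 / 2 * u n i.-1)).
    by apply: cvgD; apply: cvgMr; exact: cl.
  apply/funext => n; rewrite /u /= ltn_eqF//=.
  by congr (_ + _ * _); lra.
have lE i : (i < k)%N -> l i = l i.+1.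
  elim: i => [|i IH] ik; first by have := lS _ ik; rewrite /=; lra.
  by have := lS _ ik; rewrite /= IH ?(ltnW ik)//; lra.
have l1 i : (i <= k)%N -> l i = 1.
  move=> /subnKC; move: (k - i)%N => m; elim: m i => [|m IH] i; first by rewrite addn0 => ->.
  by move=> imk; rewrite lE; [apply: IH; rewrite addSnnS|rewrite -imk addnS ltnS leq_addr].
by move=> qk; have := cl q; rewrite l1.
Qed.

Lemma cvg_toss_prob_comes_back0 p : 0 <= p <= 1 / 2 ->
  toss_prob p n (comes_back 0) @[n --> \oo] --> (1 : R).
Proof.
move=> p12; have p01 : 0 <= p <= 1 by lra.
rewrite -(cvg_shiftS _)/= (_ : (fun n => _) = fun n => p * hit_prob p n 1 + (1 - p)).
  have c1 : p * hit_prob p n 1 @[n --> \oo] --> p * 1.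
    by apply: cvgMr; have := @cvg_hit_ever p 1 p01; rewrite hit_ever1.
  have := cvgD c1 (cvg_cst (1 - p)); rewrite mulr1 subrKC; exact.
apply/funext => n; have := toss_prob_comes_backS p n 0 => /= ->.
by rewrite (toss_prob_visits p n 0 0) hit_prob0 mulr1.
Qed.

Lemma cvg_toss_prob_comes_back_half k :
  toss_prob (1 / 2) n (comes_back k) @[n --> \oo] --> (1 : R).
Proof.
have h01 : 0 <= (1 / 2 : R) <= 1 / 2 by lra.
have h01' : 0 <= (1 / 2 : R) <= 1 by lra.
rewrite -(cvg_shiftS _) (funext (fun n => toss_prob_comes_backS (1 / 2) n k)).
have c1 : 1 / 2 * hit_prob (1 / 2) n 1 @[n --> \oo] --> (1 / 2 * 1 : R).
  by apply: cvgMr; have := @cvg_hit_ever (1 / 2) 1 h01'; rewrite hit_ever1.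
have c2 : (1 - 1 / 2) * toss_prob (1 / 2) n (visits k k.-1) @[n --> \oo]
    --> ((1 - 1 / 2) * 1 : R).
  by apply: cvgMr; apply: cvg_toss_prob_visits_below; exact: leq_pred.
have := cvgD c1 c2; rewrite !mulr1 subrKC; exact.
Qed.

(** The expected return time to k is infinite because, with probability 1/2, the
    first step is up, after which the walk has to come back down by 1. *)
Lemma sum_comes_back_unbounded k (C : R) :
  exists n, C <= \sum_(i < n) (1 - toss_prob (1 / 2) i (comes_back k)).
Proof.
have h01 : 0 <= (1 / 2 : R) <= 1 by lra.
have [n Cn] := sum_survival_unbounded (2 * C).
exists n.+1; rewrite big_ord_recl /= subr0.
have : \sum_(i < n) (1 / 2 * (1 - hit_prob (1 / 2 : R) i 1)) <=
    \sum_(i < n) (1 - toss_prob (1 / 2 : R) i.+1 (comes_back k)).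
  apply: ler_sum => i _; rewrite toss_prob_comes_backS.
  have : toss_prob (1 / 2) i (visits k k.-1) <= (1 : R).
    by have := @toss_prob_mono (1 / 2) i (visits k k.-1) predT h01; rewrite toss_prob_true; exact.
  by lra.
by rewrite -mulr_sumr /=; lra.
Qed.

End CoinTossing.

(** * Laws determined by a generating pi-system *)
Section LawUniqueness.
Context (R : realType) d1 d2 (T1 : measurableType d1) (T2 : measurableType d2).
Variables (m1 : {measure set T1 -> \bar R}) (m2 : {measure set T2 -> \bar R}).
Hypothesis m1fin : (m1 setT < +oo)%E.

Lemma law_unique d (S : measurableType d) (G : set (set S)) (g : (set S)^nat)
    (f1 : T1 -> S) (f2 : T2 -> S) :
  measurable = <<s G >> -> setI_closed G -> (forall i, G (g i)) ->
  \bigcup_k (g k) = setT ->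
  measurable_fun setT f1 -> measurable_fun setT f2 ->
  (forall A, G A -> m1 (f1 @^-1` A) = m2 (f2 @^-1` A)) ->
  forall A, measurable A -> m1 (f1 @^-1` A) = m2 (f2 @^-1` A).
Proof.
move=> mG GI Gg gT mf1 mf2 m12 A mA.
pose p1 : {measure set S -> \bar R} := pushforward m1 f1.
pose p2 : {measure set S -> \bar R} := pushforward m2 f2.
suff p1fin k : (p1 mf1 (g k) < +oo)%E.
  exact: (@measure_unique _ _ _ G g mG GI Gg gT (p1 mf1) (p2 mf2) m12 p1fin A mA).
have mg : measurable (g k) by rewrite mG; apply: sub_sigma_algebra; exact: Gg.
by have := le_measure (p1 mf1) (mem_set mg) (mem_set measurableT) (@subsetT _ _);
  rewrite /= /pushforward preimage_setT => /le_lt_trans; apply.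
Qed.

Lemma law_unique_rect d d' (S : measurableType d) (S' : measurableType d')
    (f1 : T1 -> S * S') (f2 : T2 -> S * S') :
  measurable_fun setT f1 -> measurable_fun setT f2 ->
  (forall A B, measurable A -> measurable B ->
     m1 (f1 @^-1` (A `*` B)) = m2 (f2 @^-1` (A `*` B))) ->
  forall C, measurable C -> m1 (f1 @^-1` C) = m2 (f2 @^-1` C).
Proof.
move=> mf1 mf2 m12; apply: (@law_unique _ _
  [set A `*` B | A in measurable & B in measurable] (fun=> setT)) => //.
- exact: measurable_prod_measurableType.
- move=> _ _ [A mA [B mB <-]] [A' mA' [B' mB' <-]]; rewrite -setXI.
  by exists (A `&` A'); [exact: measurableI|exists (B `&` B') => //; exact: measurableI].
- by move=> _; exists setT => //; exists setT => //; rewrite setXTT.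
- by apply/seteqP; split => // x _; exists 0%N.
- by move=> _ [A mA [B mB <-]]; exact: m12.
Qed.

Lemma law_unique_ray (f1 : T1 -> R) (f2 : T2 -> R) :
  measurable_fun setT f1 -> measurable_fun setT f2 ->
  (forall x, m1 (f1 @^-1` `]x, +oo[) = m2 (f2 @^-1` `]x, +oo[)) ->
  forall A, measurable A -> m1 (f1 @^-1` A) = m2 (f2 @^-1` A).
Proof.
move=> mf1 mf2 m12; apply: (@law_unique _ _ (@RGenOInfty.G R)
  (fun n => `]- n%:R, +oo[%classic)) => //.
- exact: RGenOInfty.measurableE.
- move=> _ _ [x ->] [y ->]; exists (Num.max x y); apply/seteqP.
  by split => z /=; rewrite !in_itv/= !andbT gt_max; [move=> [-> ->]|move=> /andP[]].
- by move=> i; exists (- i%:R).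
- apply/seteqP; split => // x _; exists (Num.bound `|x|) => //=.
  by have := archi_boundP (normr_ge0 x); rewrite in_itv/= andbT ltr_norml => /andP[].
- by move=> _ [x ->]; exact: m12.
Qed.

End LawUniqueness.

(** * Independent identically distributed pairs *)
Lemma measurable_forall_lt d (T : measurableType d) (n : nat) (F : nat -> set T) :
  (forall i, (i < n)%N -> measurable (F i)) ->
  measurable [set w | forall i, (i < n)%N -> F i w].
Proof.
move=> mF; rewrite (_ : [set w | _] = \bigcap_(i in [set i | (i < n)%N]) F i)//.
exact: bigcap_measurableType.
Qed.

Lemma independent_sequences_pair (R : realType) d (T : measurableType d)
    (P : probability T R) (X X' : nat -> {RV P >-> R}) i j A B :
  independent_sequences X X' -> measurable A -> measurable B ->
  P (X i @^-1` A `&` X' j @^-1` B) = (P (X i @^-1` A) * P (X' j @^-1` B))%E.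
Proof.
move=> iXX' mA mB; rewrite -iXX'//; apply: sub_sigma_algebra.
  by exists i, A.
by exists j, B.
Qed.

Section IidPairs.
Context (R : realType) d (T : measurableType d) (P : probability T R).
Variables (X X' : nat -> {RV P >-> R}).
Hypothesis indepX : mutually_independent X.
Hypothesis indepX' : mutually_independent X'.
Hypothesis indepXX' : independent_sequences X X'.
Hypothesis idX : forall i A, measurable A -> P (X i @^-1` A) = P (X 0%N @^-1` A).
Hypothesis idX' : forall i A, measurable A -> P (X' i @^-1` A) = P (X' 0%N @^-1` A).

Definition pair_at (i : nat) (w : T) : R * R := (X i w, X' i w).

Lemma measurable_pair_at i : measurable_fun setT (pair_at i).
Proof. exact: measurable_fun_pair. Qed.

Lemma measurable_preimage_pair_at i C : measurable C -> measurable (pair_at i @^-1` C).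
Proof. by move=> mC; rewrite -[X in measurable X]setTI; exact: measurable_pair_at. Qed.

Lemma sigma_of_forall_lt (Y : nat -> {RV P >-> R}) n (A : nat -> set R) :
  (forall i, measurable (A i)) ->
  sigma_of Y [set w | forall i, (i < n)%N -> A i (Y i w)].
Proof.
move=> mA.
apply: (@measurable_forall_lt _ (g_sigma_algebraType
  [set A | exists i (B : set R), measurable B /\ A = Y i @^-1` B]) n
  (fun i => Y i @^-1` A i)) => i _.
by apply: sub_sigma_algebra; exists i, (A i).
Qed.

Lemma mutually_independent_lt (Y : nat -> {RV P >-> R}) n (A : nat -> set R) :
  mutually_independent Y -> (forall i, measurable (A i)) ->
  P [set w | forall i, (i < n)%N -> A i (Y i w)] =
  (\prod_(0 <= i < n) P (Y i @^-1` A i))%E.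
Proof.
move=> iY mA; set J := seq_fset tt (iota 0 n).
have memJ i : (i \in J) = (i < n)%N by rewrite seq_fsetE mem_iota.
rewrite /index_iota subn0 -(undup_id (iota_uniq 0 n)) -(perm_big _ (seq_fset_perm tt _)).
rewrite -(iY J A mA); congr (P _); apply/seteqP; split => w H i.
  by move=> iJ; apply: H; rewrite -memJ.
by move=> ilt; apply: H; rewrite -memJ in ilt.
Qed.

Lemma prob_forall_lt_rect n (A B : nat -> set R) :
  (forall i, measurable (A i)) -> (forall i, measurable (B i)) ->
  P [set w | forall i, (i < n)%N -> (A i `*` B i) (pair_at i w)] =
  (\prod_(0 <= i < n) P (pair_at 0 @^-1` (A i `*` B i)))%E.
Proof.
move=> mA mB.
have rectE i A1 B1 : measurable A1 -> measurable B1 ->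
    P (pair_at i @^-1` (A1 `*` B1)) = (P (X i @^-1` A1) * P (X' i @^-1` B1))%E.
  by move=> mA1 mB1; rewrite -independent_sequences_pair.
rewrite (_ : [set w | _] = [set w | forall i, (i < n)%N -> A i (X i w)] `&`
    [set w | forall i, (i < n)%N -> B i (X' i w)]); last first.
  apply/seteqP; split => w /=; first by move=> H; split => i /H[].
  by move=> [H H'] i ilt; split; [exact: H|exact: H'].
rewrite indepXX'; [|exact: sigma_of_forall_lt..].
rewrite !mutually_independent_lt// -big_split/=.
apply: eq_bigr => i _; rewrite rectE//.
by congr (_ * _)%E; [exact: idX|exact: idX'].
Qed.

(** For measurable rectangles this is the assumed independence. General measurable
    sets replace the rectangles one index at a time: with the other indices
    fixed, both sides are finite measures in the k-th set, equal on rectangles. *)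
Lemma prob_forall_lt n (C : nat -> set (R * R)) :
  (forall i, measurable (C i)) ->
  P [set w | forall i, (i < n)%N -> C i (pair_at i w)] =
  (\prod_(0 <= i < n) P (pair_at 0 @^-1` (C i)))%E.
Proof.
pose rect (D : set (R * R)) :=
  exists A B, [/\ measurable A, measurable B & D = A `*` B].
have trunc (D1 D2 : nat -> set (R * R)) : (forall i, (i < n)%N -> D1 i = D2 i) ->
    P [set w | forall i, (i < n)%N -> D1 i (pair_at i w)] =
      (\prod_(0 <= i < n) P (pair_at 0 @^-1` (D1 i)))%E ->
    P [set w | forall i, (i < n)%N -> D2 i (pair_at i w)] =
      (\prod_(0 <= i < n) P (pair_at 0 @^-1` (D2 i)))%E.
  move=> D12; rewrite (eq_big_nat _ _ (F2 := fun i => P (pair_at 0 @^-1` D2 i))).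
    move=> <-; congr (P _); apply/seteqP.
    by split => w /= H i ilt; have := H i ilt; rewrite D12.
  by move=> i /andP[_ /D12 ->].
suff main k : forall C, (forall i, measurable (C i)) ->
    (forall i, (k <= i)%N -> rect (C i)) ->
    P [set w | forall i, (i < n)%N -> C i (pair_at i w)] =
    (\prod_(0 <= i < n) P (pair_at 0 @^-1` (C i)))%E.
  move=> mC; pose C' i := if (i < n)%N then C i else setT.
  have mC' i : measurable (C' i) by rewrite /C'; case: ifP.
  have rC' i : (n <= i)%N -> rect (C' i).
    by move=> ni; rewrite /C' ltnNge ni/=; exists setT, setT; split => //; rewrite setXTT.
  apply: (trunc C' C) (main n C' mC' rC') => i ilt.
  by rewrite /C' ilt.
elim: k => [|k IH] {}C mC rC.
  have [AB HAB] : {AB : nat -> set R * set R & forall i, [/\ measurable (AB i).1,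
      measurable (AB i).2 & C i = (AB i).1 `*` (AB i).2]}.
    apply: (@choice _ _ (fun i (p : set R * set R) => [/\ measurable p.1,
      measurable p.2 & C i = p.1 `*` p.2])) => i.
    by have [A [B ?]] := rC i isT; exists (A, B).
  rewrite (_ : C = fun i => (AB i).1 `*` (AB i).2); last by apply/funext => i; case: (HAB i).
  by apply: prob_forall_lt_rect => i; case: (HAB i).
have [nk|kn] := leqP n k.
  pose C' i := if (i < n)%N then C i else setT.
  have mC' i : measurable (C' i) by rewrite /C'; case: ifP.
  have rC' i : (k <= i)%N -> rect (C' i).
    move=> ki; rewrite /C' ltnNge (leq_trans nk ki)/=; exists setT, setT.
    by split => //; rewrite setXTT.
  apply: (trunc C' C) (IH C' mC' rC') => i ilt.
  by rewrite /C' ilt.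
pose E := [set w | forall i, (i < n)%N -> (if i == k then setT else C i) (pair_at i w)].
have mE : measurable E.
  apply: measurable_forall_lt => i _.
  by apply: measurable_preimage_pair_at; case: ifP.
pose c := (\prod_(0 <= i < n | i != k) P (pair_at 0 @^-1` (C i)))%E.
have c0 : (0 <= c)%E by apply: prode_ge0.
have cfin : c \is a fin_num.
  by apply: prode_fin_num => i _; apply: fin_num_measure; exact: measurable_preimage_pair_at.
have EE D : P [set w | forall i, (i < n)%N -> (if i == k then D else C i) (pair_at i w)] =
    mrestr P mE (pair_at k @^-1` D).
  rewrite /mrestr; congr (P _); apply/seteqP; split => w /=.
    move=> H; split; first by have := H k kn; rewrite eqxx.
    by move=> i ilt; have := H i ilt; case: ifP.
  by move=> [Dw H] i ilt; have := H i ilt; case: eqP => // ->.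
have prodE D : (\prod_(0 <= i < n) P (pair_at 0 @^-1` (if i == k then D else C i)))%E
   = mscale (NngNum (fine_ge0 c0)) P (pair_at 0 @^-1` D).
  rewrite (bigD1_seq k) ?mem_index_iota ?iota_uniq//= eqxx muleC.
  congr (_ * _)%E; rewrite fineK//; apply: eq_bigr => i /negPf -> //.
have CE i : C i = if i == k then C k else C i by case: eqP => // ->.
transitivity (mrestr P mE (pair_at k @^-1` C k)).
  by rewrite -EE; congr (P _); apply/seteqP; split => w /= H i ilt; have := H i ilt;
    rewrite -CE.
transitivity (mscale (NngNum (fine_ge0 c0)) P (pair_at 0 @^-1` C k)); last first.
  by rewrite -prodE; apply: eq_bigr => i _; rewrite -CE.
apply: (@law_unique_rect _ _ _ _ _ (mrestr P mE) (mscale (NngNum (fine_ge0 c0)) P)) => //.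
- by rewrite /= /mrestr setTI; apply: le_lt_trans (probability_le1 P mE) _; rewrite ltry.
- exact: measurable_pair_at.
- exact: measurable_pair_at.
- move=> A B mA mB.
  have mC1 i : measurable (if i == k then A `*` B else C i).
    by case: ifP => // _; exact: measurableX.
  have rC1 i : (k <= i)%N -> rect (if i == k then A `*` B else C i).
    move=> ki; case: eqP => [_|/eqP ik]; first by exists A, B.
    by apply: rC; rewrite ltn_neqAle eq_sym ik.
  by have := IH _ mC1 rC1; rewrite EE prodE.
Qed.


Definition tosses (c : pred (R * R)) (m n : nat) (w : T) : seq bool :=
  [seq c (pair_at i w) | i <- iota m n].

(** The constraint on the first m pairs is there for the induction on n, which
    moves the first toss into it. *)
Lemma prob_tosses_after (c : pred (R * R)) m n (C : nat -> set (R * R))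
    (A : pred (seq bool)) :
  measurable [set z | c z] -> (forall i, measurable (C i)) ->
  let E := [set w | (forall i, (i < m)%N -> C i (pair_at i w)) /\ A (tosses c m n w)] in
  measurable E /\
  P E = ((\prod_(0 <= i < m) P (pair_at 0 @^-1` (C i))) *
         (toss_prob (fine (P (pair_at 0 @^-1` [set z | c z]))) n A)%:E)%E.
Proof.
move=> mc; set p := fine _.
have pE : P (pair_at 0 @^-1` [set z | c z]) = p%:E.
  by rewrite fineK// fin_num_measure//; exact: measurable_preimage_pair_at.
elim: n m C A => [|n IH] m C A mC E.
  have mF : measurable [set w | forall i, (i < m)%N -> C i (pair_at i w)].
    by apply: measurable_forall_lt => i _; exact: measurable_preimage_pair_at.
  rewrite /E /tosses /=; case A0: (A [::]).
    rewrite (_ : [set _ | _] = [set w | forall i, (i < m)%N -> C i (pair_at i w)]).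
      by split=> //; rewrite mule1 prob_forall_lt.
    by apply/seteqP; split => w /= => [[]|].
  rewrite (_ : [set _ | _] = set0); first by rewrite measure0 mule0.
  by apply/seteqP; split => w /= [].
pose Cb (b : bool) i := if i == m then [set z | c z == b] else C i.
have mcb (b : bool) : measurable [set z | c z == b].
  case: b; first by rewrite (_ : [set z | _] = [set z | c z])//; apply/seteqP; split => z /= /eqP.
  rewrite (_ : [set z | _] = ~` [set z | c z]); first exact: measurableC.
  by apply/seteqP; split => z /=; case: (c z).
have mCb b i : measurable (Cb b i) by rewrite /Cb; case: ifP.
have := IH m.+1 (Cb true) (fun e => A (true :: e)) (mCb true).
set ET := [set w | _] => -[mT PT].
have := IH m.+1 (Cb false) (fun e => A (false :: e)) (mCb false).
set EF := [set w | _] => -[mF PF].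
have Eb (b : bool) w : (forall i, (i < m.+1)%N -> Cb b i (pair_at i w)) <->
    (c (pair_at m w) = b /\ forall i, (i < m)%N -> C i (pair_at i w)).
  split=> [H|[cb H] i].
    split; first by have := H m (ltnSn m); rewrite /Cb eqxx => /eqP.
    by move=> i im; have := H i (ltnW im); rewrite /Cb ltn_eqF.
  by rewrite ltnS leq_eqVlt /Cb => /orP[/eqP ->|im]; rewrite ?eqxx/= ?cb// ltn_eqF//; exact: H.
have EU : E = ET `|` EF.
  apply/seteqP; split => w.
    rewrite /E /tosses /= => -[H]; case cm: (c (pair_at m w)) => Ae; [left|right].
      by split => //; apply/Eb.
    by split => //; apply/Eb.
  rewrite /E /tosses /= => -[] [/Eb[-> H] Ae]; by split.
have EI : ET `&` EF = set0.
  by apply/seteqP; split => w //= [[/Eb[ct _] _] [/Eb[cf _] _]]; rewrite ct in cf.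
split; first by rewrite EU; exact: measurableU.
transitivity (P ET + P EF)%E; first by rewrite EU measureU.
rewrite PT PF !big_nat_recr//=.
have prodC b : (\prod_(0 <= i < m) P (pair_at 0 @^-1` Cb b i) =
    \prod_(0 <= i < m) P (pair_at 0 @^-1` C i))%E.
  by apply: eq_big_nat => i /andP[_ im]; rewrite /Cb ltn_eqF.
rewrite !prodC /Cb eqxx.
have -> : P (pair_at 0 @^-1` [set z | c z == true]) = p%:E.
  by rewrite -pE; congr (P _); apply/seteqP; split => w /= /eqP.
have -> : P (pair_at 0 @^-1` [set z | c z == false]) = (1 - p)%:E.
  rewrite EFinB -pE -probability_setC//; last exact: measurable_preimage_pair_at.
  by congr (P _); apply/seteqP; split => w /=; case: (c _).
have : (\prod_(0 <= i < m) P (pair_at 0 @^-1` C i))%E \is a fin_num.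
  by apply: prode_fin_num => i _; apply: fin_num_measure; exact: measurable_preimage_pair_at.
move=> /fineK <-; rewrite -!EFinM -EFinD; congr EFin; ring.
Qed.

Lemma measurable_tosses (c : pred (R * R)) n (A : pred (seq bool)) :
  measurable [set z | c z] -> measurable [set w | A (tosses c 0 n w)].
Proof.
move=> mc; have := @prob_tosses_after c 0 n (fun=> setT) A mc (fun=> measurableT) => -[+ _].
by rewrite (_ : [set w | _ /\ _] = [set w | A (tosses c 0 n w)])//;
  apply/seteqP; split => w //= -[].
Qed.

Lemma prob_tosses (c : pred (R * R)) n (A : pred (seq bool)) :
  measurable [set z | c z] ->
  P [set w | A (tosses c 0 n w)] =
  (toss_prob (fine (P (pair_at 0 @^-1` [set z | c z]))) n A)%:E.
Proof.
move=> mc; have := @prob_tosses_after c 0 n (fun=> setT) A mc (fun=> measurableT) => -[_].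
rewrite big_geq// mul1e => <-; congr (P _).
by apply/seteqP; split => w //= -[].
Qed.

(** ** Exchangeability *)
Definition cylinder (C : set (nat -> R * R)) : Prop :=
  exists n D, (forall i : nat, measurable (D i)) /\
    C = [set s | forall i, (i < n)%N -> D i (s i)].

Definition path_space : Type := g_sigma_algebraType (cylinder : set (set (nat -> R * R))).
HB.instance Definition _ := Measurable.on path_space.

Lemma measurable_coord (i : nat) : measurable_fun setT (fun s : path_space => s i).
Proof.
move=> _ C mC; rewrite setTI; apply: sub_sigma_algebra.
exists i.+1, (fun j => if j == i then C else setT); split; first by move=> j; case: ifP.
apply/seteqP; split => s /=; first by move=> Cs j _; case: eqP => // ->.
by move=> /(_ i (ltnSn i)); rewrite eqxx.
Qed.

Definition reversal (n i : nat) : nat := if (i < n)%N then (n - i.+1)%N else i.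

Lemma reversalK n : involutive (reversal n).
Proof.
move=> i; rewrite /reversal; have [ni|ni] := ltnP i n; last by rewrite ltnNge ni.
by rewrite ifT; lia.
Qed.

Lemma reversal_lt n m i : (n <= m)%N -> (i < m)%N -> (reversal n i < m)%N.
Proof. by rewrite /reversal; case: ifP; lia. Qed.

Lemma measurable_fun_paths (f : nat -> nat) :
  measurable_fun setT (fun w => (fun i => pair_at (f i) w) : path_space).
Proof.
apply: (@measurability _ _ T path_space setT _ cylinder) => //.
move=> _ [_ [n [D [mD ->]] <-]]; rewrite setTI.
apply: (@measurable_forall_lt _ _ n (fun i => pair_at (f i) @^-1` D i)) => i _.
exact: measurable_preimage_pair_at.
Qed.

(** Permuting i.i.d. pairs permutes the factors of the probability of a cylinder,
    and cylinders generate the sigma-algebra of the path space. *)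
Lemma prob_path_reversal n (C : set path_space) : measurable C ->
  P [set w | C (fun i => pair_at i w)] = P [set w | C (fun i => pair_at (reversal n i) w)].
Proof.
apply: (@law_unique _ _ _ _ _ P P _ _ path_space cylinder (fun=> setT)
   (fun w i => pair_at i w) (fun w i => pair_at (reversal n i) w)) => //.
- by apply: (le_lt_trans (probability_le1 P measurableT)); rewrite ltry.
- move=> _ _ [n1 [D1 [mD1 ->]]] [n2 [D2 [mD2 ->]]].
  exists (maxn n1 n2), (fun i => (if (i < n1)%N then D1 i else setT) `&`
                                 (if (i < n2)%N then D2 i else setT)); split.
    by move=> i; apply: measurableI; case: ifP.
  apply/seteqP; split => s /=.
    by move=> [H1 H2] i _; split; case: ifP => // il; [exact: H1|exact: H2].
  move=> H; split => i il; have /H[] : (i < maxn n1 n2)%N by rewrite leq_max il ?orbT.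
    by rewrite il.
  by rewrite il.
- by move=> _; exists 0%N, (fun=> setT); split => //; apply/seteqP; split.
- by apply/seteqP; split => // x _; exists 0%N.
- exact: (measurable_fun_paths id).
- exact: (measurable_fun_paths (reversal n)).
move=> _ [n1 [D1 [mD1 ->]]].
pose N := maxn n n1; pose D i := if (i < n1)%N then D1 i else setT.
have nN : (n <= N)%N by exact: leq_maxl.
have mD i : measurable (D i) by rewrite /D; case: ifP.
have DE s : (forall i, (i < n1)%N -> D1 i (s i)) <-> (forall i, (i < N)%N -> D i (s i)).
  split=> H i il; first by rewrite /D; case: ifP => // /H.
  by have := H i; rewrite /D il; apply; rewrite (leq_trans il)// leq_maxr.
transitivity (P [set w | forall i, (i < N)%N -> D i (pair_at i w)]).
  by congr (P _); apply/seteqP; split => w /= /DE.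
transitivity (P [set w | forall i, (i < N)%N -> D (reversal n i) (pair_at i w)]); last first.
  congr (P _); apply/seteqP; split => w /= H.
    apply/(DE (fun i => pair_at (reversal n i) w)) => i iN.
    by have := H _ (reversal_lt nN iN); rewrite reversalK.
  move=> i iN; have /DE := H => /(_ _ (reversal_lt nN iN)).
  by rewrite reversalK.
rewrite prob_forall_lt// (@prob_forall_lt _ (fun i => D (reversal n i)))// !big_mkord.
pose h (i : 'I_N) := Ordinal (reversal_lt nN (ltn_ord i)).
rewrite (reindex_inj (h := h))//.
by move=> i j /(congr1 val)/= /(can_inj (@reversalK n)) /val_inj.
Qed.

End IidPairs.

(** * The Mittag-Leffler function near 0 *)
Section GammaBounds.
Variable R : realType.
Implicit Types x M : R.

Let integrand x (t : R) := t `^ (x - 1) * expR (- t).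

Let integrand_ge0 x t : 0 <= integrand x t.
Proof. by rewrite mulr_ge0 ?powR_ge0 ?expR_ge0. Qed.

Let measurable_integrand x (D : set R) : measurable_fun D (fun t => (integrand x t)%:E).
Proof.
apply: measurable_funTS; apply/measurable_EFinP; apply: measurable_funM.
  exact: measurable_powR.
by apply: measurableT_comp => //; exact: measurable_oppr.
Qed.

Lemma Gamma_inv_ge0 x : 0 <= (Gamma x)^-1.
Proof.
rewrite invr_ge0 /Gamma; apply: fine_ge0; apply: integral_ge0 => t _.
by rewrite lee_fin integrand_ge0.
Qed.

(** The integrand is at least M^(x-1) e^(-(M+1)) on the interval from M to M+1. *)
Let integral_ge x M : 1 <= x -> 0 < M ->
  ((M `^ (x - 1) * expR (- (M + 1)))%:E <=
   \int[lebesgue_measure]_(t in `]0%R, +oo[) (integrand x t)%:E)%E.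
Proof.
move=> x1 M0.
have -> : ((M `^ (x - 1) * expR (- (M + 1)))%:E =
    \int[lebesgue_measure]_(t in `[M, (M + 1)%R]) (M `^ (x - 1) * expR (- (M + 1)))%:E)%E.
  rewrite integral_cst//= lebesgue_measure_itv/= lte_fin ltrDl ltr01 -EFinD.
  by rewrite addrAC subrr add0r mule1.
apply: (@le_trans _ _ (\int[lebesgue_measure]_(t in `[M, (M + 1)%R]) (integrand x t)%:E)%E).
  apply: ge0_le_integral => //.
  - by move=> t _; rewrite lee_fin mulr_ge0 ?powR_ge0 ?expR_ge0.
  - exact: measurable_integrand.
  - move=> t /=; rewrite in_itv/= => /andP[Mt tM]; rewrite lee_fin ler_pM ?powR_ge0 ?expR_ge0//.
      by apply: ge0_ler_powR; rewrite ?nnegrE//; lra.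
    by rewrite ler_expR lerN2.
apply: ge0_subset_integral => //.
- exact: measurable_integrand.
- by move=> t _; rewrite lee_fin integrand_ge0.
- by move=> t /=; rewrite !in_itv/= andbT => /andP[Mt _]; rewrite (lt_le_trans M0).
Qed.

(** When Euler's integral diverges, [Gamma] is 0 by convention and so is its
    inverse. *)
Lemma Gamma_inv_le x M : 1 <= x -> 0 < M ->
  (Gamma x)^-1 <= expR (M + 1) * M `^ (1 - x).
Proof.
move=> x1 M0; rewrite /Gamma /Rintegral; set I := (\int[_]_(_ in _) _)%E.
have lb : ((M `^ (x - 1) * expR (- (M + 1)))%:E <= I)%E by exact: integral_ge.
have rhs0 : 0 <= expR (M + 1) * M `^ (1 - x) by rewrite mulr_ge0 ?expR_ge0 ?powR_ge0.
case: I lb => [r| |]; [|by rewrite /= invr0|by rewrite leeNy_eq].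
rewrite lee_fin /= => lb.
have b0 : 0 < M `^ (x - 1) * expR (- (M + 1)) by rewrite mulr_gt0 ?powR_gt0 ?expR_gt0.
have -> : expR (M + 1) * M `^ (1 - x) = (M `^ (x - 1) * expR (- (M + 1)))^-1.
  by rewrite invfM -powRN opprB -expRN opprK mulrC.
by rewrite lef_pV2// posrE (lt_le_trans b0).
Qed.

(** For 1 <= x <= 2, t^(x-1) <= 1 + t <= 2 e^(t/2), so that 4 times the density of
    the exponential law of rate 1/2 dominates the integrand. *)
Lemma Gamma_gt0 x : 1 <= x <= 2 -> 0 < Gamma x.
Proof.
move=> x12; rewrite -invr_gt0 lt_def Gamma_inv_ge0 andbT invr_eq0.
rewrite /Gamma /Rintegral; set I := (\int[_]_(_ in _) _)%E.
have Ioo : (I < +oo)%E.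
  have half0 : 0 < (2^-1 : R) by rewrite invr_gt0.
  have : (I <= \int[lebesgue_measure]_t (4%:E * (exponential_pdf 2^-1 t)%:E))%E.
    apply: (@le_trans _ _ (\int[lebesgue_measure]_(t in `]0%R, +oo[)
        (4%:E * (exponential_pdf 2^-1 t)%:E))%E).
      apply: ge0_le_integral => //.
      - by move=> t _; rewrite lee_fin integrand_ge0.
      - exact: measurable_integrand.
      - apply: measurable_funeM; apply: measurable_funTS.
        by apply/measurable_EFinP; apply: measurable_exponential_pdf; exact: ltW.
      move=> t /=; rewrite in_itv/= andbT => t0.
      rewrite -EFinM lee_fin exponential_pdfE; last exact: ltW.
      have -> : 4 * (2^-1 * expR (- 2^-1 * t)) = 2 * expR (t / 2) * expR (- t).
        rewrite -mulrA -expRD mulrA; congr (_ * expR _); lra.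
      rewrite ler_wpM2r ?expR_ge0//.
      have : 1 + t / 2 <= expR (t / 2) := expR_ge1Dx _.
      suff : t `^ (x - 1) <= 1 + t by lra.
      have [t1|t1] := leP 1 t.
        by have := ler1_powR t1 (_ : x - 1 <= 1); lra.
      have : t `^ (x - 1) <= t `^ 0 by apply: ger_powR; lra.
      by rewrite powRr0; lra.
    apply: ge0_subset_integral => //.
    - apply: measurable_funeM.
      by apply/measurable_EFinP; apply: measurable_exponential_pdf; exact: ltW.
    - by move=> t _; rewrite mule_ge0// lee_fin exponential_pdf_ge0// ltW.
  move=> /le_lt_trans; apply; rewrite ge0_integralZl//; last 2 first.
  - by apply/measurable_EFinP; apply: measurable_exponential_pdf; exact: ltW.
  - by move=> t _; rewrite lee_fin exponential_pdf_ge0// ltW.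
  by rewrite integral_exponential_pdf// mule1 ltry.
have I0 : (0 < I)%E.
  have x1 : 1 <= x by lra.
  apply: (lt_le_trans _ (integral_ge x1 ltr01)).
  by rewrite lte_fin mulr_gt0 ?powR_gt0 ?expR_gt0.
by rewrite gt_eqF// fine_gt0// I0.
Qed.

End GammaBounds.

Section EntireSeries.
Variable R : realType.
Implicit Types (c : R^nat) (x K : R).

(** The coefficients of an entire series, in a form stable under termwise
    differentiation. *)
Definition rapid_decay c := forall K, 0 < K -> exists C, forall n, `|c n| * K ^+ n <= C.

(** The factor n + 1 <= 2^(n+1) is absorbed by doubling K, and the shift of the
    index by taking K + 1 >= 1 in place of K. *)
Lemma rapid_decay_diffs c : rapid_decay c -> rapid_decay (pseries_diffs c).
Proof.
move=> dc K K0; have K10 : 0 < 2 * (K + 1) by lra.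
have [C HC] := dc _ K10; exists C => n; apply: le_trans (HC n.+1).
rewrite /pseries_diffs normrM ger0_norm// mulrC mulrA.
rewrite [leRHS]mulrC; apply: ler_wpM2r => //.
rewrite exprMn mulrC; apply: ler_pM => //.
- by rewrite exprn_ge0// ltW.
- by rewrite -natrX ler_nat ltnW// ltn_expl.
- apply: (@le_trans _ _ ((K + 1) ^+ n)).
    by apply: lerXn2r; rewrite ?nnegrE; lra.
  by rewrite exprS ler_peMl ?exprn_ge0//; lra.
Qed.

Lemma rapid_decay_cvg c x : rapid_decay c -> cvgn (pseries c x).
Proof.
move=> dc; pose K := 2 * (`|x| + 1).
have K0 : 0 < K by rewrite /K; have := normr_ge0 x; lra.
have [C HC] := dc _ K0.
have C0 : 0 <= C by apply: le_trans (HC 0%N); apply: mulr_ge0 => //; exact/exprn_ge0/ltW.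
apply: normed_cvg; apply: (@series_le_cvg _ _ (geometric C (1 / 2))) => //.
- by move=> n; exact: normr_ge0.
- by move=> n; apply: mulr_ge0 => //; apply: exprn_ge0; lra.
- move=> n /=; apply: le_trans (_ : `|c n| * (`|x| + 1) ^+ n <= _).
    have x0 := normr_ge0 x.
    by rewrite normrM ler_wpM2l// normrX lerXn2r ?nnegrE//; lra.
  have := HC n; rewrite /K exprMn => H.
  rewrite div1r exprVn ler_pdivlMr ?exprn_gt0//.
  by move: H; rewrite mulrA mulrAC.
- by apply: is_cvg_geometric_series; rewrite ger0_norm; lra.
Qed.

Lemma rapid_decay_is_derive c x : rapid_decay c ->
  is_derive x (1 : R) (fun x => limn (pseries c x)) (limn (pseries (pseries_diffs c) x)).
Proof.
move=> dc; apply: (@pseries_snd_diffs _ c (`|x| + 1)).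
- exact: rapid_decay_cvg.
- exact/rapid_decay_cvg/rapid_decay_diffs.
- exact/rapid_decay_cvg/rapid_decay_diffs/rapid_decay_diffs.
- by rewrite [ltRHS]ger0_norm ?addr_ge0// ltrDl.
Qed.

Lemma rapid_decay_continuous c : rapid_decay c ->
  continuous (fun x => limn (pseries c x)).
Proof.
move=> dc x; have [D _] := rapid_decay_is_derive x dc.
by apply: differentiable_continuous; exact/derivable1_diffP.
Qed.

Lemma pseries_at0 c : limn (pseries c 0) = c 0%N.
Proof.
apply/cvg_lim => //; rewrite -(cvg_shiftS _)/=.
rewrite (_ : (fun n => _) = fun=> c 0%N); first exact: cvg_cst.
apply/funext => n; rewrite /pseries /series/= big_nat_recl// expr0 mulr1.
by rewrite big1_seq ?addr0// => i _; rewrite expr0n mulr0.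
Qed.

(** The derivative is continuous and equals c 1 at 0. *)
Lemma pseries_incr_near0 c : rapid_decay c -> 0 < c 1%N ->
  exists2 e : R, 0 < e &
    {in `]- e, e[%R &, {homo (fun x => limn (pseries c x)) : x y / x < y}}.
Proof.
move=> dc c1.
have := rapid_decay_continuous (rapid_decay_diffs dc) (x := 0).
rewrite /continuous_at /= pseries_at0 /pseries_diffs mul1r => /cvgr_gt /(_ _ c1).
rewrite near_nbhs => /nbhs_ballP[e /= e0 He]; exists e => //.
apply: gtr0_derive1_lt_oo.
- by move=> x _; have [] := rapid_decay_is_derive x dc.
- move=> x; rewrite in_itv/= => xe; rewrite derive1E.
  have [_ ->] := rapid_decay_is_derive x dc; apply: He.
  by rewrite /ball /= sub0r normrN ltr_norml.
- by move=> x _; exact: rapid_decay_continuous.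
Qed.

End EntireSeries.

Section MittagLeffler.
Variables (R : realType) (a : R).
Hypothesis a01 : 0 < a < 1.

Let c (l : nat) : R := (Gamma (1 + a * l%:R))^-1.

Lemma mittag_lefflerE (x : R) : mittag_leffler a 1 x = limn (pseries c x).
Proof.
rewrite /mittag_leffler /pseries; congr (limn (series _)).
by apply/funext => l; rewrite mulrC.
Qed.

(** [Gamma_inv_le] with M = K^(1/a) turns M^(- a l) into K^(-l). *)
Lemma rapid_decay_mittag_leffler : rapid_decay c.
Proof.
move=> K K0; pose M := K `^ a^-1.
have M0 : 0 < M by exact: powR_gt0.
exists (expR (M + 1)) => l.
rewrite ger0_norm ?Gamma_inv_ge0//.
have /andP[a0 _] := a01.
have al : 0 <= a * l%:R by rewrite mulr_ge0// ltW.
have x1 : 1 <= 1 + a * l%:R by lra.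
have := Gamma_inv_le x1 M0.
have -> : M `^ (1 - (1 + a * l%:R)) = (K ^+ l)^-1.
  rewrite opprD addrA subrr add0r /M -powRrM mulrN mulrA mulVf ?mul1r; last first.
    by rewrite gt_eqF.
  by rewrite powRN powR_mulrn ?ltW.
by rewrite ler_pdivlMr ?exprn_gt0.
Qed.

Lemma continuous_mittag_leffler : continuous (mittag_leffler a 1).
Proof.
rewrite (funext mittag_lefflerE).
exact/rapid_decay_continuous/rapid_decay_mittag_leffler.
Qed.

(** The coefficient of degree 1 is 1 / Gamma (1 + a), which is positive. *)
Lemma mittag_leffler_incr_near0 : exists2 e : R, 0 < e &
  {in `]- e, e[%R &, {homo mittag_leffler a 1 : x y / x < y}}.
Proof.
rewrite (funext mittag_lefflerE); apply: pseries_incr_near0.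
  exact: rapid_decay_mittag_leffler.
by have := a01 => ?; rewrite /c invr_gt0 Gamma_gt0//; lra.
Qed.

End MittagLeffler.

(** ** The law of a Mittag-Leffler variable *)
Section MittagLefflerVariable.
Context (R : realType) d (T : measurableType d) (P : probability T R).
Variables (X : {RV P >-> R}) (a l : R).
Hypotheses (a01 : 0 < a < 1) (l0 : 0 < l) (MLX : is_mittag_leffler_RV X a l).

Lemma ccdf_mittag_leffler x : 0 <= x ->
  ccdf X x = (mittag_leffler a 1 (- (l * x) `^ a))%:E.
Proof. by move=> x0; rewrite MLX.2// powRM// ltW. Qed.

Lemma ccdf_rayE x : ccdf X x = P [set w | x < X w].
Proof.
by congr (P _); apply/seteqP; split => w /=; rewrite in_itv/= andbT.
Qed.

Lemma mittag_leffler_RV_gt0 : P [set w | 0 < X w] = 1%E.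
Proof.
have mX : measurable [set w | 0 < X w].
  rewrite (_ : [set w | _] = X @^-1` `]0, +oo[).
    exact: measurable_funPTI.
  by apply/seteqP; split => w /=; rewrite in_itv/= andbT.
have [N [mN PN sN]] := MLX.1.
have : P (~` [set w | 0 < X w]) = 0%E.
  apply/eqP; rewrite -measure_le0 -PN le_measure ?inE//; exact: measurableC.
rewrite probability_setC// => /eqP; rewrite sube_eq ?fin_num_measure//.
by rewrite add0e => /eqP.
Qed.

Lemma mittag_leffler_RV_no_atom x : P [set w | X w = x] = 0%E.
Proof.
have mx y : measurable [set w | y < X w].
  rewrite (_ : [set w | _] = X @^-1` `]y, +oo[); first exact: measurable_funPTI.
  by apply/seteqP; split => w /=; rewrite in_itv/= andbT.
have mxe : measurable [set w | X w = x].
  exact: (@measurable_funPTI _ _ _ _ X [set x]).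
have [x0|x0] := leP x 0.
  have : P (~` [set w | 0 < X w]) = 0%E.
    by rewrite probability_setC// mittag_leffler_RV_gt0 subee.
  move=> PN; apply/eqP; rewrite -measure_le0 -PN le_measure ?inE//.
    exact: measurableC.
  by move=> w /= ->; rewrite ltNge x0.
pose f y := mittag_leffler a 1 (- (l * y) `^ a).
have cf : {for x, continuous f}.
  have c1 : {for x, continuous (fun y : R => l * y)} by exact: mulrl_continuous.
  have c2 : {for l * x, continuous (fun y : R => y `^ a)}.
    apply: differentiable_continuous; apply/derivable1_diffP.
    by apply: derivable_powR; rewrite in_itv/= andbT mulr_gt0.
  have c3 : {for x, continuous (fun y : R => - (l * y) `^ a)}.
    exact: cvgN (continuous_comp c1 c2).
  by apply: (continuous_comp c3); exact: continuous_mittag_leffler.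
have le1 y : 0 <= y < x -> (P [set w | X w = x] <= (f y - f x)%:E)%E.
  move=> /andP[y0 yx]; have x0' := ltW x0.
  rewrite EFinB -!ccdf_mittag_leffler// !ccdf_rayE leeBrDr ?fin_num_measure//.
  rewrite -measureU//; last first.
    by apply/seteqP; split => w //= [->]; rewrite ltxx.
  rewrite le_measure ?inE//; first exact: measurableU.
  by move=> w /= [->//|]; exact: lt_trans.
have Pfin : P [set w | X w = x] \is a fin_num by exact: fin_num_measure.
rewrite -(fineK Pfin); congr EFin; apply/eqP; rewrite eq_le fine_ge0// andbT.
apply/ler_addgt0Pr => e e0; rewrite add0r.
have /cvgrPdist_lt /(_ _ e0) := cf; rewrite near_nbhs => /nbhs_ballP[r /= r0 Hr].
pose y := Num.max 0 (x - r / 2).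
have y0x : 0 <= y < x by rewrite /y le_max lexx/= gt_max x0/=; lra.
have := le1 y y0x; rewrite -(fineK Pfin) lee_fin => /le_trans; apply.
have : ball x r y.
  rewrite /ball /= ger0_norm; last by move: y0x; lra.
  have : x - r / 2 <= y by rewrite /y le_max lexx orbT.
  by lra.
by move=> /Hr; rewrite distrC => /(le_lt_trans (ler_norm _)) /ltW.
Qed.

(** The mass of a small interval is a difference of two values of the strictly
    increasing function E_a near 0. *)
Lemma mittag_leffler_RV_charges_near0 : exists2 e : R, 0 < e &
  forall u v, 0 < u -> u < v -> v < e -> (0 < P [set w | (u < X w <= v)%R])%E.
Proof.
have [e e0 He] := mittag_leffler_incr_near0 a01.
have mx y : measurable [set w | y < X w].
  rewrite (_ : [set w | _] = X @^-1` `]y, +oo[); first exact: measurable_funPTI.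
  by apply/seteqP; split => w /=; rewrite in_itv/= andbT.
have /andP[a0 _] := a01.
pose e' := e `^ a^-1 / l.
exists e' => [|u v u0 uv ve]; first by rewrite divr_gt0// powR_gt0.
have v0 : 0 < v by exact: lt_trans uv.
have pv y : 0 < y -> y < e' -> (l * y) `^ a < e.
  move=> y0 ye; have -> : e = (e `^ a^-1) `^ a.
    by rewrite -powRrM mulVf ?powRr1 ?gt_eqF ?ltW.
  apply: gt0_ltr_powR; rewrite ?nnegrE ?powR_ge0 ?mulr_ge0 ?ltW//.
  by rewrite mulrC -ltr_pdivlMr.
have puv : (l * u) `^ a < (l * v) `^ a.
  by apply: gt0_ltr_powR; rewrite ?nnegrE ?mulr_ge0 ?ltW// ltr_pM2l.
have fuv : mittag_leffler a 1 (- (l * v) `^ a) < mittag_leffler a 1 (- (l * u) `^ a).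
  apply: He; last by rewrite ltrN2.
  - by rewrite in_itv/= ltrN2 pv//= (le_lt_trans _ e0)// oppr_le0 powR_ge0.
  - by rewrite in_itv/= ltrN2 pv ?(lt_trans uv)//= (le_lt_trans _ e0)// oppr_le0 powR_ge0.
have : (ccdf X v < ccdf X u)%E by rewrite !ccdf_mittag_leffler ?ltW// lte_fin.
rewrite !ccdf_rayE => lt_uv.
have E : [set w | u < X w] = [set w | u < X w <= v] `|` [set w | v < X w].
  apply/seteqP; split => w /=.
    by move=> uX; rewrite uX/=; case: leP; [left|right].
  by move=> [/andP[]//|]; exact: lt_trans.
have mE : measurable [set w | u < X w <= v].
  rewrite (_ : [set w | _] = X @^-1` `]u, v]); first exact: measurable_funPTI.
  by apply/seteqP; split => w /=; rewrite in_itv.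
rewrite lt0e measure_ge0 andbT; apply/eqP => P0.
have D0 : [set w | u < X w <= v] `&` [set w | v < X w] = set0.
  by apply/seteqP; split => w //= [/andP[_ +]]; rewrite leNgt => /negP.
have PE : P [set w | u < X w] = (P [set w | (u < X w <= v)%R] + P [set w | (v < X w)%R])%E.
  by rewrite E measureU.
by move: lt_uv; rewrite PE P0 add0e ltxx.
Qed.

End MittagLefflerVariable.

(** * The critical ratio *)
Section MonotoneLimits.
Context (R : realType) d (T : measurableType d) (P : probability T R).
Implicit Types (F : (set T)^nat) (c : \bar R).

Lemma probability_bigcup_le F c : (forall n, measurable (F n)) -> nondecreasing_seq F ->
  (forall n, P (F n) <= c)%E -> (P (\bigcup_n F n) <= c)%E.
Proof.
move=> mF ndF Fc.
have cF := nondecreasing_cvg_mu (mu := P) mF (bigcupT_measurable F mF) ndF.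
rewrite -(cvg_lim _ cF)//; apply: lime_le; first exact: cvgP cF.
by near=> n; exact: Fc.
Unshelve. all: by end_near. Qed.

Lemma probability_bigcap_ge F c : (forall n, measurable (F n)) -> nonincreasing_seq F ->
  (forall n, c <= P (F n))%E -> (c <= P (\bigcap_n F n))%E.
Proof.
move=> mF niF Fc.
have F0 : (P (F 0%N) < +oo)%E by apply: le_lt_trans (probability_le1 P (mF _)) (ltry _).
have cF := nonincreasing_cvg_mu F0 mF (bigcapT_measurable mF) niF.
rewrite -(cvg_lim _ cF)//; apply: lime_ge; first exact: cvgP cF.
by near=> n; exact: Fc.
Unshelve. all: by end_near. Qed.

Lemma probability_le A B : measurable A -> measurable B -> A `<=` B -> (P A <= P B)%E.
Proof. by move=> mA mB; apply: le_measure; rewrite inE. Qed.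

Lemma probabilityU_le A B : measurable A -> measurable B ->
  (P (A `|` B) <= P A + P B)%E.
Proof. exact: measureU2. Qed.

Lemma measurable_RV_lt (X Y : {RV P >-> R}) (s : R) : measurable [set w | X w < s * Y w].
Proof.
have msY : measurable_fun setT (fun w => s * Y w) by exact: measurable_funM.
have := measurable_fun_ltr (@measurable_funPT _ _ _ _ X) msY.
by move=> /(_ measurableT [set true] I); rewrite setTI.
Qed.

Lemma measurable_RV_gt (X : {RV P >-> R}) (s : R) : measurable [set w | s < X w].
Proof.
rewrite (_ : [set w | _] = X @^-1` `]s, +oo[); first exact: measurable_funPTI.
by apply/seteqP; split => w /=; rewrite in_itv/= andbT.
Qed.

End MonotoneLimits.

(** For independent positive variables X and X', X without atoms and both with mass
    in every interval close to 0, the probability of X < s X' crosses 1/2 exactly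
    once as s grows. *)
Section Threshold.
Context (R : realType) d (T : measurableType d) (P : probability T R).
Variables (X X' : {RV P >-> R}).
Hypothesis indep : forall A B, measurable A -> measurable B ->
  P (X @^-1` A `&` X' @^-1` B) = (P (X @^-1` A) * P (X' @^-1` B))%E.
Hypotheses (X0 : P [set w | 0 < X w] = 1%E) (X'0 : P [set w | 0 < X' w] = 1%E).
Hypothesis noatom : forall x, P [set w | X w = x] = 0%E.
Hypothesis near0 : exists2 e : R, 0 < e &
  forall u v, 0 < u -> u < v -> v < e -> (0 < P [set w | (u < X w <= v)%R])%E.
Hypothesis near0' : exists2 e : R, 0 < e &
  forall u v, 0 < u -> u < v -> v < e -> (0 < P [set w | (u < X' w <= v)%R])%E.

(** On the almost sure event 0 < X' the events are monotone in s. *)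
Let ev (s : R) := [set w | 0 < X' w /\ X w < s * X' w].

Let mev s : measurable (ev s).
Proof. by apply: measurableI; [exact: measurable_RV_gt|exact: measurable_RV_lt]. Qed.

Let g (s : R) := P (ev s).

Let null_X'_le0 : P (~` [set w | 0 < X' w]) = 0%E.
Proof. by rewrite probability_setC ?X'0 ?subee//; exact: measurable_RV_gt. Qed.

Let gE s : P [set w | X w < s * X' w] = g s.
Proof.
have mlt := measurable_RV_lt X X' s.
apply/eqP; rewrite eq_le; apply/andP; split; last first.
  by apply: le_measure; rewrite ?inE// => w [].
rewrite -[leRHS]adde0 -null_X'_le0.
have mC : measurable (~` [set w | 0 < X' w]) by apply: measurableC; exact: measurable_RV_gt.
rewrite -measureU//; last by apply/seteqP; split => w //= [[? _]].
apply: le_measure; rewrite ?inE//; first exact: measurableU.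
by move=> w /= lt1; have [X'w|X'w] := ltP 0 (X' w); [left|right].
Qed.

(** With X' in ]y, r y] and X in ]s r y, t y] one has s X' < X < t X'. The
    ratio r between 1 and t / s leaves room for both intervals, and y small keeps
    them where the two laws have mass. *)
Let g_lt s t : 0 < s -> s < t -> (g s < g t)%E.
Proof.
move=> s0 st; have [e e0 He] := near0; have [e' e'0 He'] := near0'.
have t0 : 0 < t := lt_trans s0 st.
pose r := (s + t) / (2 * s).
have r1 : 1 < r by rewrite /r ltr_pdivlMr; lra.
have r0 : 0 < r by exact: lt_trans r1.
pose y := Num.min (e / (2 * t)) (e' / (2 * r)).
have y0 : 0 < y.
  by rewrite lt_min; apply/andP; split; apply: divr_gt0 => //; apply: mulr_gt0.
have sry : s * (r * y) = (s + t) / 2 * y.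
  by rewrite /r; field; rewrite gt_eqF.
have ye : y <= e / (2 * t) by rewrite ge_min lexx.
have ye' : y <= e' / (2 * r) by rewrite ge_min lexx orbT.
have te : t * y < e.
  move: ye; rewrite ler_pdivlMr ?mulr_gt0// => ye.
  have : 0 < t * y := mulr_gt0 t0 y0.
  by lra.
have re' : r * y < e'.
  have r20 : 0 < 2 * r by rewrite pmulr_rgt0.
  move: ye'; rewrite ler_pdivlMr// => ye'.
  have : 0 < r * y := mulr_gt0 r0 y0.
  by lra.
have yry : y < r * y by rewrite ltr_pMl.
have srty : s * (r * y) < t * y by rewrite sry ltr_pM2r//; lra.
have sry0 : 0 < s * (r * y) by exact: mulr_gt0 s0 (mulr_gt0 r0 y0).
have PX := He _ _ sry0 srty te.
have PX' := He' _ _ y0 yry re'.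
have itvE (Z : {RV P >-> R}) u v : [set w | u < Z w <= v] = Z @^-1` `]u, v].
  by apply/seteqP; split => w /=; rewrite in_itv.
have mitv (Z : {RV P >-> R}) u v : measurable [set w | u < Z w <= v].
  by rewrite itvE; exact: measurable_funPTI.
pose E := [set w | s * (r * y) < X w <= t * y] `&` [set w | y < X' w <= r * y].
have mE : measurable E by exact: measurableI.
have PE : (0 < P E)%E.
  rewrite /E !itvE indep// -!itvE; exact: mule_gt0.
have D0 : ev s `&` E = set0.
  apply/seteqP; split => w //= [[_ lt1] [/andP[lt2 _] /andP[_ le3]]].
  have : s * X' w <= s * (r * y) by rewrite ler_pM2l.
  by move: lt1 lt2; lra.
have sub : ev s `|` E `<=` ev t.
  move=> w /= [[X'w lt1]|[/andP[lt1 le2] /andP[lt3 le4]]].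
    by split => //; apply: (lt_trans lt1); rewrite ltr_pM2r.
  by split; [exact: lt_trans lt3|apply: (le_lt_trans le2); rewrite ltr_pM2l].
have UE : P (ev s `|` E) = (g s + P E)%E by rewrite measureU.
apply: (@lt_le_trans _ _ (g s + P E)%E).
  by rewrite lteDl// fin_num_measure.
by rewrite -UE le_measure ?inE//; exact: measurableU.
Qed.

(** Fubini: given X', the event X = s X' asks X to sit on one point. *)
Let no_tie s : 0 < s -> P [set w | X w = s * X' w] = 0%E.
Proof.
move=> s0.
pose f w := (X' w, X w).
have mf : measurable_fun setT f by exact: measurable_fun_pair.
pose m' : {measure set (R * R) -> \bar R} := pushforward P f.
have m'E A B : measurable A -> measurable B ->
    m' mf (A `*` B) = (distribution P X' A * distribution P X B)%E.
  by move=> mA mB; rewrite /distribution /pushforward muleC -indep// setIC.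
pose D := [set z : R * R | z.2 = s * z.1].
have mD : measurable D.
  have mh : measurable_fun setT (fun z : R * R => z.2 - s * z.1).
    apply: measurable_funB; first exact: measurable_snd.
    by apply: measurable_funM => //; exact: measurable_fst.
  have := mh measurableT [set 0] (measurable_set1 0); rewrite setTI.
  rewrite (_ : _ @^-1` _ = D)//; apply/seteqP; split => z /=.
    by move/eqP; rewrite subr_eq0 => /eqP.
  by move=> ->; rewrite subrr.
have <- : m' mf D = P [set w | X w = s * X' w] by [].
rewrite -(product_measure_unique m'E mD) /product_measure1.
apply: integral0_eq => y _ /=; rewrite -[RHS](noatom (s * y)).
by congr (P _); apply/seteqP; split => w /=; rewrite /xsection/= inE.
Qed.

Let ev_mono s t : s <= t -> ev s `<=` ev t.
Proof.
move=> st w [X'w lt1]; split => //; apply: (lt_le_trans lt1).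
by rewrite ler_pM2r.
Qed.

Let exists_below : exists2 s, 0 < s & (g s < (1 / 2)%:E)%E.
Proof.
apply: contrapT => H.
pose F n := ev n.+1%:R^-1.
have niF : nonincreasing_seq F.
  move=> n m nm; apply/subsetPset; apply: ev_mono.
  by rewrite lef_pV2 ?posrE ?ltr0n// ler_nat.
have : ((1 / 2)%:E <= P (\bigcap_n F n))%E.
  apply: probability_bigcap_ge => // n; first exact: mev.
  rewrite leNgt; apply/negP => lt1.
  by apply: H; exists n.+1%:R^-1 => //; rewrite invr_gt0 ltr0n.
have : (P (\bigcap_n F n) <= P (~` [set w | (0 < X w)%R]))%E.
  apply: le_measure; rewrite ?inE.
  - by apply: bigcapT_measurable => n; exact: mev.
  - by apply: measurableC; exact: measurable_RV_gt.
  move=> w Fw /= Xw; have [X'w _] := Fw 0%N I.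
  pose n := Num.bound (X' w / X w).
  have [_] := Fw n I; rewrite mulrC ltr_pdivlMr ?ltr0n// => lt1.
  have : X' w / X w < n%:R by apply: archi_boundP; rewrite divr_ge0// ltW.
  rewrite ltr_pdivrMr// => lt2.
  have : n%:R * X w <= X w * n.+1%:R by rewrite mulrC ler_pM2l// ler_nat.
  by lra.
rewrite probability_setC ?X0 ?subee//; last exact: measurable_RV_gt.
by move=> le0 /le_trans /(_ le0); rewrite lee_fin; lra.
Qed.

Let exists_above : exists2 s, 0 < s & ((1 / 2)%:E < g s)%E.
Proof.
apply: contrapT => H.
pose F n := ev n.+1%:R.
have ndF : nondecreasing_seq F.
  by move=> n m nm; apply/subsetPset; apply: ev_mono; rewrite ler_nat.
have : (P (\bigcup_n F n) <= (1 / 2)%:E)%E.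
  apply: probability_bigcup_le => // n; first exact: mev.
  rewrite leNgt; apply/negP => lt1.
  by apply: H; exists n.+1%:R.
have : (P [set w | (0 < X' w)%R] <= P (\bigcup_n F n))%E.
  apply: le_measure; rewrite ?inE.
  - exact: measurable_RV_gt.
  - by apply: bigcupT_measurable => n; exact: mev.
  move=> w /= X'w; pose n := Num.bound (`|X w| / X' w).
  exists n => //; split => //.
  have : `|X w| / X' w < n%:R by apply: archi_boundP; rewrite divr_ge0// ltW.
  rewrite ltr_pdivrMr// => lt2; apply: (le_lt_trans (ler_norm _)).
  by apply: (lt_le_trans lt2); rewrite ler_pM2r// ler_nat.
by rewrite X'0 => le1 /(le_trans le1); rewrite lee_fin; lra.
Qed.

Let g_le_left s : 0 < s -> (forall t, 0 < t < s -> (g t <= (1 / 2)%:E)%E) ->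
  (g s <= (1 / 2)%:E)%E.
Proof.
move=> s0 H; pose a n : R := s * (1 - n.+2%:R^-1).
have as_ n : 0 < a n < s.
  have : 0 < (n.+2%:R^-1 : R) by rewrite invr_gt0 ltr0n.
  have : (n.+2%:R^-1 : R) < 1 by rewrite invf_lt1 ?ltr0n// ltr1n.
  rewrite /a; move: (n.+2%:R^-1) => v v1 v0.
  have v10 : 0 < 1 - v by lra.
  have v11 : 1 - v < 1 by lra.
  by rewrite mulr_gt0//= gtr_pMr.
pose F n := ev (a n).
have ndF : nondecreasing_seq F.
  move=> n m nm; apply/subsetPset; apply: ev_mono; rewrite /a ler_pM2l// lerD2l lerN2.
  by rewrite lef_pV2 ?posrE ?ltr0n// ler_nat.
have : (P (\bigcup_n F n) <= (1 / 2)%:E)%E.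
  by apply: probability_bigcup_le => // n; [exact: mev|exact: H].
apply: le_trans; apply: le_measure; rewrite ?inE//.
  by apply: bigcupT_measurable => n; exact: mev.
move=> w [X'w lt1].
have e0 : 0 < s * X' w - X w by lra.
have sX0 : 0 < s * X' w by rewrite mulr_gt0.
pose n := Num.bound ((s * X' w) / (s * X' w - X w)).
exists n => //; split => //.
have : (s * X' w) / (s * X' w - X w) < n%:R.
  by apply: archi_boundP; rewrite divr_ge0 ?ltW.
rewrite ltr_pdivrMr// => lt2.
have lt3 : s * X' w < n.+2%:R * (s * X' w - X w).
  by apply: (lt_le_trans lt2); rewrite ler_pM2r// ler_nat ltnW.
have -> : a n * X' w = s * X' w - n.+2%:R^-1 * (s * X' w) by rewrite /a; ring.
by rewrite ltrBrDl -ltrBrDr mulrC ltr_pdivrMr ?ltr0n// [ltRHS]mulrC.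
Qed.

Let g_ge_right s : 0 < s -> (forall t, s < t -> ((1 / 2)%:E <= g t)%E) ->
  ((1 / 2)%:E <= g s)%E.
Proof.
move=> s0 H; pose a n : R := s * (1 + n.+1%:R^-1).
have as_ n : s < a n.
  by rewrite /a ltr_pMr// ltrDl invr_gt0 ltr0n.
pose F n := ev (a n).
have niF : nonincreasing_seq F.
  move=> n m nm; apply/subsetPset; apply: ev_mono; rewrite /a ler_pM2l// lerD2l.
  by rewrite lef_pV2 ?posrE ?ltr0n// ler_nat.
have : ((1 / 2)%:E <= P (\bigcap_n F n))%E.
  by apply: probability_bigcap_ge => // n; [exact: mev|exact: H].
have mtie : measurable [set w | X w = s * X' w].
  have mh : measurable_fun setT (fun w => X w - s * X' w).
    by apply: measurable_funB => //; apply: measurable_funM.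
  have := mh measurableT [set 0] (measurable_set1 0); rewrite setTI.
  rewrite (_ : _ @^-1` _ = [set w | X w = s * X' w])//; apply/seteqP; split => z /=.
    by move/eqP; rewrite subr_eq0 => /eqP.
  by move=> ->; rewrite subrr.
move=> /le_trans; apply.
rewrite -[leRHS]adde0 -(no_tie s0) -measureU//; last first.
  by apply/seteqP; split => w //= [[_ lt1] E]; move: lt1; rewrite E ltxx.
apply: le_measure; rewrite ?inE.
- by apply: bigcapT_measurable => n; exact: mev.
- apply: measurableU => //; exact: mev.
move=> w Fw; have [X'w _] := Fw 0%N I.
suff : X w <= s * X' w by rewrite le_eqVlt => /orP[/eqP ?|?]; [right|left].
rewrite leNgt; apply/negP => lt1.
have e0 : 0 < X w - s * X' w by lra.
have sX0 : 0 < s * X' w by rewrite mulr_gt0.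
pose n := Num.bound ((s * X' w) / (X w - s * X' w)).
have : (s * X' w) / (X w - s * X' w) < n%:R.
  by apply: archi_boundP; rewrite divr_ge0 ?ltW.
rewrite ltr_pdivrMr// => lt2.
have lt3 : s * X' w < n.+1%:R * (X w - s * X' w).
  by apply: (lt_le_trans lt2); rewrite ler_pM2r// ler_nat.
have [_] := Fw n I.
have -> : a n * X' w = s * X' w + n.+1%:R^-1 * (s * X' w) by rewrite /a; ring.
rewrite -ltrBlDl [ltRHS]mulrC ltr_pdivlMr ?ltr0n//.
by move: lt3; rewrite mulrC; lra.
Qed.

Lemma threshold : exists2 r, 0 < r &
  [/\ P [set w | X w < r * X' w] = (1 / 2)%:E,
      forall s, 0 < s -> s < r ->
        (0%E < P [set w | (X w < s * X' w)%R] < (1 / 2)%:E)%E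
    & forall s, r < s -> ((1 / 2)%:E < P [set w | (X w < s * X' w)%R])%E].
Proof.
have [s1 s10 g1] := exists_below; have [s2 s20 g2] := exists_above.
pose S := [set s | 0 < s /\ (g s <= (1 / 2)%:E)%E].
have S1 : S s1 by split => //; exact: ltW.
have Sub : ubound S s2.
  move=> s [s0 gs]; rewrite leNgt; apply/negP => lt1.
  by have := lt_le_trans (lt_trans g2 (g_lt s20 lt1)) gs; rewrite ltxx.
have hS : has_sup S by split; [exists s1|exists s2].
pose r := sup S.
have r0 : 0 < r by apply: (lt_le_trans s10); exact: sup_upper_bound.
have below s : 0 < s -> s < r -> (g s < (1 / 2)%:E)%E.
  move=> s0 sr; have rs0 : 0 < r - s by lra.
  have [t [t0 gt]] := sup_adherent rs0 hS; rewrite -/r => st.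
  by apply: (lt_le_trans _ gt); apply: g_lt => //; lra.
have above s : r < s -> ((1 / 2)%:E < g s)%E.
  move=> rs; rewrite ltNge; apply/negP => gs.
  suff : s <= r by lra.
  by apply: sup_upper_bound => //; split => //; exact: lt_trans rs.
exists r => //; split.
- rewrite gE; apply/eqP; rewrite eq_le; apply/andP; split.
    by apply: g_le_left => // t /andP[t0 tr]; apply/ltW/below.
  by apply: g_ge_right => // t rt; exact/ltW/above.
- move=> s s0 sr; rewrite gE below// andbT.
  have s20' : 0 < s / 2 by lra.
  by apply: (le_lt_trans _ (g_lt s20' _)) => //; lra.
- by move=> s rs; rewrite gE above.
Qed.

End Threshold.

(** A change of the scale of a Mittag-Leffler law is a multiplication of the
    variable, so the inputs with parameters (l, m) have the arrival probability
    P0 (Y < s Y') for one fixed input (Y, Y') and s proportional to l / m. *)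
Section Scaling.
Context (R : realType) d (T : measurableType d) (P : probability T R).
Context d0 (T0 : measurableType d0) (P0 : probability T0 R).

Lemma law_mittag_leffler_scale (X : {RV P >-> R}) (X0 : {RV P0 >-> R}) (a l l0 : R) :
  0 < l -> 0 < l0 -> is_mittag_leffler_RV X a l -> is_mittag_leffler_RV X0 a l0 ->
  forall A, measurable A -> P (X @^-1` A) = P0 ((fun w => l0 / l * X0 w) @^-1` A).
Proof.
move=> lp l0p HX HX0; have c0 : 0 < l0 / l by rewrite divr_gt0.
have mcX0 : measurable_fun setT (fun w => l0 / l * X0 w) by exact: measurable_funM.
apply: law_unique_ray => //.
  by apply: (le_lt_trans (probability_le1 P measurableT)); rewrite ltry.
move=> x.
have -> : X @^-1` `]x, +oo[ = [set w | x < X w].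
  by apply/seteqP; split => w /=; rewrite in_itv/= andbT.
have -> : (fun w => l0 / l * X0 w) @^-1` `]x, +oo[ = [set w | x / (l0 / l) < X0 w].
  by apply/seteqP; split => w /=; rewrite in_itv/= andbT ltr_pdivrMr// mulrC.
have [x0|x0] := leP 0 x.
  transitivity (ccdf X x); first by rewrite ccdf_rayE.
  transitivity (ccdf X0 (x / (l0 / l))); last by rewrite ccdf_rayE.
  rewrite (ccdf_mittag_leffler lp HX)// (ccdf_mittag_leffler l0p HX0).
    by congr (mittag_leffler _ _ (- (_ `^ _)))%:E; field; rewrite !gt_eqF.
  by rewrite divr_ge0// ltW.
have one d1 (T1 : measurableType d1) (P1 : probability T1 R) (Z : {RV P1 >-> R}) b m y :
    is_mittag_leffler_RV Z b m -> y < 0 -> P1 [set w | y < Z w] = 1%E.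
  move=> HZ y0; apply/eqP; rewrite eq_le probability_le1 /=; last exact: measurable_RV_gt.
  rewrite -(mittag_leffler_RV_gt0 HZ); apply: le_measure; rewrite ?inE.
  - exact: measurable_RV_gt.
  - exact: measurable_RV_gt.
  - by move=> w /=; exact: lt_trans.
transitivity (1 : \bar R)%E; first exact: one HX x0.
by apply/esym/(one _ _ _ _ _ _ _ HX0); rewrite pmulr_llt0// invr_gt0.
Qed.

Lemma prob_arrival_scale (X X' : nat -> {RV P >-> R}) (Y Y' : nat -> {RV P0 >-> R})
    (a b l m l0 m0 : R) :
  0 < l -> 0 < m -> 0 < l0 -> 0 < m0 ->
  renewal_queue_input a b l m X X' -> renewal_queue_input a b l0 m0 Y Y' ->
  P [set w | X 0%N w < X' 0%N w] =
  P0 [set w | Y 0%N w < l / m * (m0 / l0) * Y' 0%N w].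
Proof.
move=> lp mp l0p m0p [[_ HX] [_ HX'] iX] [[_ HY] [_ HY'] iY].
pose f1 w := (X 0%N w, X' 0%N w); pose f2 w := (l0 / l * Y 0%N w, m0 / m * Y' 0%N w).
have mf1 : measurable_fun setT f1 by exact: measurable_fun_pair.
have mf2 : measurable_fun setT f2.
  by apply: measurable_fun_pair; exact: measurable_funM.
have mD : measurable [set z : R * R | z.1 < z.2].
  have := measurable_fun_ltr (@measurable_fst _ _ R R) (@measurable_snd _ _ R R).
  by move=> /(_ measurableT [set true] I); rewrite setTI.
transitivity (P (f1 @^-1` [set z : R * R | z.1 < z.2])); first by [].
transitivity (P0 (f2 @^-1` [set z : R * R | z.1 < z.2])).
  apply: law_unique_rect => //.
    by apply: (le_lt_trans (probability_le1 P measurableT)); rewrite ltry.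
  move=> A B mA mB.
  transitivity (P (X 0%N @^-1` A) * P (X' 0%N @^-1` B))%E.
    by rewrite -independent_sequences_pair.
  rewrite (law_mittag_leffler_scale lp l0p (HX 0%N) (HY 0%N))//.
  rewrite (law_mittag_leffler_scale mp m0p (HX' 0%N) (HY' 0%N))//.
  have preim (c : R) C : measurable C -> measurable ((fun x => c * x) @^-1` C).
    move=> mC; rewrite -[X in measurable X]setTI.
    have : measurable_fun setT (fun x : R => c * x) by exact: measurable_funM.
    by apply.
  have := independent_sequences_pair 0%N 0%N iY (preim (l0 / l) _ mA) (preim (m0 / m) _ mB).
  by move=> <-.
congr (P0 _); apply/seteqP; split => w /=.
  rewrite -(ltr_pM2l (_ : 0 < l / l0)) ?divr_gt0//.
  have -> : l / l0 * (l0 / l * Y 0%N w) = Y 0%N w by field; rewrite !gt_eqF.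
  have -> // : l / l0 * (m0 / m * Y' 0%N w) = l / m * (m0 / l0) * Y' 0%N w.
  by field; rewrite !gt_eqF.
rewrite -(ltr_pM2l (_ : 0 < l0 / l)) ?divr_gt0//.
have -> // : l0 / l * (l / m * (m0 / l0) * Y' 0%N w) = m0 / m * Y' 0%N w.
by field; rewrite !gt_eqF.
Qed.

End Scaling.

(** The laws used to find the threshold are those of an arbitrary input, for any
    scales; if there is none, the claim is vacuous. *)
Lemma critical_ratio (R : realType) (a b : R) : 0 < a < 1 -> 0 < b < 1 ->
  exists rho : R, 0 < rho /\
    forall (l m : R), 0 < l -> 0 < m ->
    forall d (T : measurableType d) (P : probability T R) (X X' : nat -> {RV P >-> R}),
    renewal_queue_input a b l m X X' ->
    [/\ l / m = rho -> arrival_probability X X' = 1 / 2,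
        l / m < rho -> 0 < arrival_probability X X' < 1 / 2
      & rho < l / m -> 1 / 2 < arrival_probability X X' <= 1].
Proof.
move=> a01 b01.
have [|noinput] := pselect (exists (l0 m0 : R), 0 < l0 /\ 0 < m0 /\
  exists d0 (T0 : measurableType d0) (P0 : probability T0 R) (Y Y' : nat -> {RV P0 >-> R}),
  renewal_queue_input a b l0 m0 Y Y'); last first.
  exists 1; split => // l m l0 m0 d T P X X' input; exfalso; apply: noinput.
  by exists l, m; split => //; split => //; exists d, T, P, X, X'.
move=> [l0 [m0 [l0p [m0p [d0 [T0 [P0 [Y [Y' inY]]]]]]]]].
have [[_ HY] [_ HY'] iY] := inY.
have [r r0 [req rlt rgt]] := @threshold _ _ _ P0 (Y 0%N) (Y' 0%N)
  (fun A B => @independent_sequences_pair _ _ _ _ Y Y' 0%N 0%N A B iY)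
  (mittag_leffler_RV_gt0 (HY 0%N)) (mittag_leffler_RV_gt0 (HY' 0%N))
  (mittag_leffler_RV_no_atom a01 l0p (HY 0%N))
  (mittag_leffler_RV_charges_near0 a01 l0p (HY 0%N))
  (mittag_leffler_RV_charges_near0 b01 m0p (HY' 0%N)).
exists (r * (l0 / m0)); split; first by rewrite mulr_gt0 ?divr_gt0.
move=> l m lp mp d T P X X' inX.
have mXX' : measurable [set w | X 0%N w < X' 0%N w].
  by have := measurable_RV_lt (X 0%N) (X' 0%N) 1; under eq_set do rewrite mul1r.
have pE : P [set w | X 0%N w < X' 0%N w] = (arrival_probability X X')%:E.
  by rewrite /arrival_probability fineK// fin_num_measure.
have p1 : arrival_probability X X' <= 1.
  by rewrite -lee_fin -pE probability_le1.
have E := prob_arrival_scale lp mp l0p m0p inX inY.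
rewrite pE in E.
have lm : l / m * (m0 / l0) * (l0 / m0) = l / m by field; rewrite !gt_eqF.
have k0 : 0 < l0 / m0 by rewrite divr_gt0.
rewrite -lm; set s := l / m * (m0 / l0) in E *.
have s0 : 0 < s by rewrite /s mulr_gt0 ?divr_gt0.
split.
- move=> /(mulIf (lt0r_neq0 k0)) sr; move: E; rewrite sr req.
  by move=> [].
- rewrite ltr_pM2r// => sr; have /andP[] := rlt _ s0 sr; rewrite -E !lte_fin => -> ->.
  by [].
- by rewrite ltr_pM2r// => sr; have := rgt _ sr; rewrite -E lte_fin p1 => ->.
Qed.

(** * Recurrence and transience of the embedded chain *)
Lemma visitsP k q e :
  reflect (exists2 m, (m <= size e)%N & queue_fwd q (take m e) = k) (visits k q e).
Proof.
elim: e q => [|b e IH] q /=.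
  by rewrite orbF; apply: (iffP eqP) => [<-|[m _ <-]]; first by exists 0%N.
apply: (iffP orP) => [[/eqP E|/IH[m me E]]|[[_ E|m me E]]].
- by exists 0%N.
- by exists m.+1.
- by left; apply/eqP.
- by right; apply/IH; exists m.
Qed.

Lemma comes_backP k e :
  reflect (exists m, [/\ (0 < m)%N, (m <= size e)%N & queue_fwd k (take m e) = k])
          (comes_back k e).
Proof.
case: e => [|b e] /=; first by right => -[[|m] []].
apply: (iffP (visitsP _ _ _)) => [[m me E]|[[|m] [//_ me E]]].
  by exists m.+1.
by exists m.
Qed.

Section RenewalQueue.
Context (R : realType) d (T : measurableType d) (P : probability T R).
Variables (X X' : nat -> {RV P >-> R}).
Hypothesis indepX : mutually_independent X.
Hypothesis indepX' : mutually_independent X'.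
Hypothesis indepXX' : independent_sequences X X'.
Hypothesis idX : forall i A, measurable A -> P (X i @^-1` A) = P (X 0%N @^-1` A).
Hypothesis idX' : forall i A, measurable A -> P (X' i @^-1` A) = P (X' 0%N @^-1` A).

Let arr : pred (R * R) := fun z => z.1 < z.2.

Lemma measurable_arrival : measurable [set z : R * R | z.1 < z.2].
Proof.
have := measurable_fun_ltr (@measurable_fst _ _ R R) (@measurable_snd _ _ R R).
by move=> /(_ measurableT [set true] I); rewrite setTI.
Qed.

Let p := arrival_probability X X'.

Definition arrivals (n : nat) (w : T) : seq bool := tosses X X' arr 0 n w.

Lemma size_arrivals n w : size (arrivals n w) = n.
Proof. by rewrite size_map size_iota. Qed.

Lemma take_arrivals m n w : (m <= n)%N -> take m (arrivals n w) = arrivals m w.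
Proof. by move=> mn; rewrite /arrivals /tosses -map_take take_iota (minn_idPl mn). Qed.

Lemma arrivalsS n w : arrivals n.+1 w = rcons (arrivals n w) (X n w < X' n w).
Proof. by rewrite /arrivals /tosses -addn1 iotaD map_cat cats1. Qed.

Lemma embedded_queueE q n w : embedded_queue X X' q n w = queue_fwd q (arrivals n w).
Proof.
elim: n => // n IH.
by rewrite arrivalsS /queue_fwd -cats1 foldl_cat /= IH.
Qed.

Lemma measurable_arrivals n (A : pred (seq bool)) : measurable [set w | A (arrivals n w)].
Proof. by apply: measurable_tosses => //; exact: measurable_arrival. Qed.

Lemma prob_arrivals n (A : pred (seq bool)) :
  P [set w | A (arrivals n w)] = (toss_prob p n A)%:E.
Proof. by rewrite prob_tosses//; exact: measurable_arrival. Qed.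

Lemma p_itv : 0 <= p <= 1.
Proof.
apply/andP; split; first exact: fine_ge0.
have m0 : measurable [set w | X 0%N w < X' 0%N w].
  by have := measurable_arrivals 1 (fun e => head false e).
by rewrite -lee_fin fineK ?fin_num_measure// probability_le1.
Qed.

Lemma comes_back_embedded k n w :
  comes_back k (arrivals n w) <->
  exists m, [/\ (0 < m)%N, (m <= n)%N & embedded_queue X X' k m w = k].
Proof.
split=> [/comes_backP[m [m0 mn E]]|[m [m0 mn E]]].
  by rewrite size_arrivals in mn; exists m; split; rewrite ?embedded_queueE// -(take_arrivals _ mn).
by apply/comes_backP; exists m; rewrite size_arrivals take_arrivals// -embedded_queueE.
Qed.

Lemma returns_bigcup k :
  returns (embedded_queue X X') k = \bigcup_n [set w | comes_back k (arrivals n w)].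
Proof.
apply/seteqP; split => w /=.
  by move=> [n [n0 E]]; exists n => //; apply/comes_back_embedded; exists n.
by move=> [n _ /comes_back_embedded[m [m0 _ E]]]; exists m.
Qed.

Lemma nondecreasing_comes_back k :
  nondecreasing_seq (fun n => [set w | comes_back k (arrivals n w)]).
Proof.
move=> m n mn; apply/subsetPset => w /= /comes_back_embedded[i [i0 im E]].
by apply/comes_back_embedded; exists i; split => //; exact: leq_trans mn.
Qed.

Lemma measurable_returns k : measurable (returns (embedded_queue X X') k).
Proof.
by rewrite returns_bigcup; apply: bigcupT_measurable => n; exact: measurable_arrivals.
Qed.

Lemma returns_eq1 k : toss_prob p n (comes_back k) @[n --> \oo] --> (1 : R) ->
  P (returns (embedded_queue X X') k) = 1%E.
Proof.
move=> c1; apply/eqP; rewrite eq_le probability_le1//=; last exact: measurable_returns.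
have mr := measurable_returns k.
rewrite -(fineK (fin_num_measure P _ mr)) lee_fin.
rewrite -(cvg_lim _ c1)//; apply: limr_le; first exact: cvgP c1.
near=> n; rewrite -lee_fin -prob_arrivals fineK ?fin_num_measure//.
apply: le_measure; rewrite ?inE//; first exact: measurable_arrivals.
by rewrite returns_bigcup => w H; exists n.
Unshelve. all: by end_near. Qed.

Lemma transient_embedded : 1 / 2 < p -> transient P (embedded_queue X X').
Proof.
move=> p12 k; have /andP[p0 p1] := p_itv.
apply: (@le_lt_trans _ _ (2 * (1 - p))%:E); last by rewrite lte_fin; lra.
rewrite returns_bigcup; apply: probability_bigcup_le.
- by move=> n; exact: measurable_arrivals.
- exact: nondecreasing_comes_back.
- by move=> n; rewrite prob_arrivals lee_fin toss_prob_comes_back_transient// p12.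
Qed.

Lemma recurrent_embedded : p <= 1 / 2 -> ~ transient P (embedded_queue X X').
Proof.
move=> p12 /(_ 0%N); rewrite returns_eq1 ?ltxx//.
by apply: cvg_toss_prob_comes_back0; have /andP[-> _] := p_itv.
Qed.

(** The sum counts the i < n up to which no return has occurred; its integral is
    the sum of [sum_comes_back_unbounded]. *)
Lemma return_time_ge k n w :
  ((\sum_(i < n) (~~ comes_back k (arrivals i w))%:R)%:E <=
   return_time R (embedded_queue X X') k w)%E.
Proof.
apply: le_ereal_inf_tmp => _ [m [m0 E] <-]; rewrite lee_fin.
apply: (@le_trans _ _ (\sum_(i < n) (i < m)%N%:R)).
  apply: ler_sum => i _; rewrite ler_nat; case: ltnP => //= mi; first exact: leq_b1.
  by rewrite leqn0 eqb0 negbK; apply/comes_back_embedded; exists m.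
rewrite -natr_sum ler_nat.
elim: n => [|n IH]; first by rewrite big_ord0.
rewrite big_ord_recr/=; case: ltnP => nm; last by rewrite addn0.
rewrite addn1 (leq_ltn_trans _ nm)//.
apply: leq_trans (_ : \sum_(i < n) 1 <= _)%N; last by rewrite sum1_card card_ord.
by apply: leq_sum => i _; exact: leq_b1.
Qed.

Lemma measurable_return_time k :
  measurable_fun setT (return_time R (embedded_queue X X') k).
Proof.
apply: (measurability _ (ErealGenInftyO.measurableE R)) => _ /= -[_ [r ->] <-].
rewrite setTI (_ : _ @^-1` _ = \bigcup_(n in [set n | (0 < n)%N /\ n%:R < r])
    [set w | queue_fwd k (arrivals n w) == k]).
  by apply: bigcup_measurable => n _; exact: (measurable_arrivals n (fun e => queue_fwd k e == k)).
apply/seteqP; split => w /=.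
  rewrite in_itv/= => /ereal_inf_lt[_ [n [n0 E] <-]]; rewrite lte_fin => nr.
  by exists n => //=; rewrite -embedded_queueE E.
move=> [n [n0 nr] /= /eqP E]; rewrite in_itv/=.
apply/ereal_inf_ltP; exists n%:R%:E; last by rewrite lte_fin.
by exists n => //; split => //; rewrite embedded_queueE.
Qed.

Lemma null_recurrent_embedded : p = 1 / 2 -> null_recurrent P (embedded_queue X X').
Proof.
move=> p12 k; split.
  by apply: returns_eq1; rewrite p12; exact: cvg_toss_prob_comes_back_half.
apply/eqyP => A A0.
have [n An] := sum_comes_back_unbounded k A.
pose f (i : nat) (w : T) : \bar R := (\1_[set w | ~~ comes_back k (arrivals i w)] w)%:E.
have mN i : measurable [set w | ~~ comes_back k (arrivals i w)].
  exact: (measurable_arrivals i (fun e => ~~ comes_back k e)).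
have mf i : measurable_fun setT (f i).
  by apply/measurable_EFinP; exact: measurable_indic.
apply: (@le_trans _ _ (\int[P]_w (\sum_(i <- iota 0 n) f i w))%E); last first.
  apply: ge0_le_integral => //.
  - by move=> w _; apply: sume_ge0 => i _; rewrite lee_fin.
  - exact: emeasurable_sum.
  - exact: measurable_return_time.
  - move=> w _; apply: le_trans (return_time_ge k n w).
    rewrite sumEFin lee_fin le_eqVlt; apply/orP; left; apply/eqP.
    rewrite -(big_mkord xpredT (fun i => (~~ comes_back k (arrivals i w))%:R)).
    rewrite /index_iota subn0; apply: eq_bigr => i _.
    rewrite indicE; congr (nat_of_bool _)%:R; apply/idP/idP; first by rewrite inE.
    by move=> ?; rewrite inE.
rewrite ge0_integral_sum//; last by move=> i w _; rewrite lee_fin.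
rewrite (eq_bigr (fun i => (1 - toss_prob (1 / 2) i (comes_back k))%:E)); last first.
  move=> i _; transitivity (P (~` [set w | comes_back k (arrivals i w)])).
    rewrite /f integral_indic// setIT; congr (P _).
    by apply/seteqP; split => w /= /negP.
  rewrite probability_setC; last exact: measurable_arrivals.
  by rewrite prob_arrivals p12 EFinB.
rewrite sumEFin lee_fin; apply: (le_trans An).
by rewrite -(big_mkord xpredT (fun i => 1 - toss_prob (1 / 2) i (comes_back k))) /index_iota subn0.
Qed.

End RenewalQueue.

(** * The number of events up to time t *)

Definition last_event (R : realType) (T : Type) (X X' : nat -> T -> R) (k : nat) (t : R) : set T :=
  [set w | event_time X X' k w <= t /\
           forall j, event_time X X' j w <= t -> (j <= k)%N].

Section LastEvent.
Context (R : realType) (T : Type) (X X' : nat -> T -> R).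

Lemma last_event_inj k k' t w : last_event X X' k t w -> last_event X X' k' t w -> k = k'.
Proof. by move=> [Tk Hk] [Tk' Hk']; apply/eqP; rewrite eqn_leq Hk'// Hk. Qed.

Lemma renewal_count_last k t w : last_event X X' k t w -> renewal_count X X' t w = k.
Proof.
move=> Lk; apply: xget_unique => // k' Lk'.
exact: (last_event_inj Lk' Lk).
Qed.

Lemma renewal_count_none t w : (forall k, ~ last_event X X' k t w) ->
  renewal_count X X' t w = 0%N.
Proof. exact: xgetPN. Qed.

(** The second part collects the paths with infinitely many events up to time t,
    on which [renewal_count] takes its default value 0. *)
Lemma queue_length_eq q j t :
  [set w | queue_length X X' q t w = j] =
  (\bigcup_k (last_event X X' k t `&` [set w | embedded_queue X X' q k w = j])) `|`
  ((\bigcap_k ~` last_event X X' k t) `&` [set w | q = j]).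
Proof.
apply/seteqP; split => w /=; rewrite /queue_length.
  have [[k Lk]|/forallNP nL] := pselect (exists k, last_event X X' k t w).
    by rewrite (renewal_count_last Lk) => E; left; exists k.
  by rewrite (renewal_count_none nL) => E; right; split => // k _; exact: nL.
move=> [[k _ [Lk <-]]|[nL <-]]; first by rewrite (renewal_count_last Lk).
by rewrite (renewal_count_none (fun k => nL k I)).
Qed.

Lemma embedded_queue_fwd q n w :
  embedded_queue X X' q n w = queue_fwd q [seq X i w < X' i w | i <- iota 0 n].
Proof.
elim: n => // n IH.
by rewrite -addn1 iotaD map_cat /queue_fwd foldl_cat /= addn1 /= IH.
Qed.

Lemma event_time_le m n w : (forall i, 0 <= X i w) -> (forall i, 0 <= X' i w) ->
  (m <= n)%N -> event_time X X' m w <= event_time X X' n w.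
Proof.
move=> X0 X'0 mn; rewrite /event_time (big_cat_nat _ mn)//= lerDl.
by apply: sumr_ge0 => i _; rewrite le_min X0 X'0.
Qed.

Lemma last_event_exists n t w : (forall i, 0 <= X i w) -> (forall i, 0 <= X' i w) ->
  0 <= t -> t < event_time X X' n w -> exists k, last_event X X' k t w.
Proof.
move=> X0 X'0 t0 tn.
have ex0 : exists k, event_time X X' k w <= t.
  by exists 0%N; rewrite /event_time big_geq.
have ub k : event_time X X' k w <= t -> (k <= n)%N.
  move=> kt; rewrite leqNgt; apply/negP => /ltnW nk.
  by have := event_time_le X0 X'0 nk; lra.
by case: (ex_maxnP ex0 ub) => k kt kmax; exists k.
Qed.

Lemma event_time_ge_count (e : R) n w :
  (forall i, 0 <= X i w) -> (forall i, 0 <= X' i w) -> 0 <= e ->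
  e * (count id [seq (e < X i w) && (e < X' i w) | i <- iota 0 n])%:R <=
  event_time X X' n w.
Proof.
move=> X0 X'0 e0; elim: n => [|n IH]; first by rewrite mulr0 /event_time big_geq.
rewrite -addn1 iotaD map_cat count_cat natrD mulrDr addn1 /event_time big_nat_recr//=.
rewrite lerD// addn0; case: andP => [[h1 h2]|_] /=.
  by rewrite mulr1 le_min !ltW.
by rewrite mulr0 le_min X0 X'0.
Qed.

Lemma event_time_perm (f : nat -> nat) n w :
  (forall i, (i < n)%N -> (f i < n)%N) -> injective f ->
  event_time (fun i => X (f i)) (fun i => X' (f i)) n w = event_time X X' n w.
Proof.
move=> fn finj; rewrite /event_time !big_mkord.
have fn' (i : 'I_n) : (f i < n)%N by exact: fn.
rewrite [RHS](reindex_inj (h := fun i => Ordinal (fn' i)))//.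
by move=> i j /(congr1 val) /= fij; apply: val_inj; exact: finj.
Qed.

End LastEvent.

Section Measurability.
Context (R : realType) d (T : measurableType d) (X X' : nat -> T -> R).
Hypotheses (mX : forall i, measurable_fun setT (X i)) (mX' : forall i, measurable_fun setT (X' i)).

Lemma measurable_event_time n : measurable_fun setT (event_time X X' n).
Proof. by apply: measurable_sum => i; exact: measurable_minr. Qed.

Lemma measurable_event_time_le n t : measurable [set w | event_time X X' n w <= t].
Proof.
have := measurable_event_time n measurableT (measurable_itv `]-oo, t]).
by rewrite setTI (_ : _ @^-1` _ = [set w | event_time X X' n w <= t])//;
  apply/seteqP; split => w /=; rewrite in_itv.
Qed.

Lemma measurable_last_event k t : measurable (last_event X X' k t).
Proof.
apply: measurableI; first exact: measurable_event_time_le.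
rewrite (_ : (fun w => _) = \bigcap_(j in [set j | ~~ (j <= k)%N])
    ~` [set w | event_time X X' j w <= t]).
  by apply: bigcap_measurableType => j _; apply: measurableC; exact: measurable_event_time_le.
apply/seteqP; split => w /=; first by move=> H j /= /negP jk /H.
by move=> H j jt; apply/negP => /negP jk; exact: H jt.
Qed.

Lemma measurable_embedded_queue q n j : measurable [set w | embedded_queue X X' q n w = j].
Proof.
elim: n j => [|n IH] j.
  have [->|qj] := eqVneq q j.
    by rewrite (_ : [set _ | _] = setT)//; apply/seteqP; split.
  rewrite (_ : [set _ | _] = set0)//; apply/seteqP.
  by split => // w /= qj'; move: qj; rewrite qj' eqxx.
have mlt : measurable [set w | X n w < X' n w].
  by have := measurable_fun_ltr (mX n) (mX' n) measurableT (Y := [set true]) I; rewrite setTI.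
have mcst (b : Prop) : measurable [set w : T | b].
  have [h|h] := pselect b.
    by rewrite (_ : [set _ | _] = setT)//; apply/seteqP; split.
  by rewrite (_ : [set _ | _] = set0)//; apply/seteqP; split.
rewrite (_ : [set w | _] = \bigcup_i ([set w | embedded_queue X X' q n w = i] `&`
   (([set w | X n w < X' n w] `&` [set w | i.+1 = j]) `|`
    (~` [set w | X n w < X' n w] `&` [set w | i.-1 = j])))).
  apply: bigcupT_measurable => i; apply: measurableI => //.
  by apply: measurableU; apply: measurableI => //; exact: measurableC.
apply/seteqP; split => w /=.
  by case: ifPn => [lt E|/negP nlt E]; exists (embedded_queue X X' q n w) => //; split => //;
    [left|right].
by move=> [i _ [-> [[-> E]|[/negP/negPf -> E]]]].
Qed.

End Measurability.

(** * Equilibrium *)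
Lemma map_reversal (A : Type) (f : nat -> A) n :
  [seq f (reversal n i) | i <- iota 0 n] = rev [seq f i | i <- iota 0 n].
Proof.
apply: (@eq_from_nth _ (f 0%N)); rewrite ?size_rev !size_map !size_iota// => i ilt.
rewrite nth_rev size_map size_iota// !(nth_map 0%N) ?size_iota ?nth_iota//; try lia.
by rewrite /reversal ilt.
Qed.

Section Equilibrium.
Context (R : realType) d (T : measurableType d) (P : probability T R).
Variables (X X' : nat -> {RV P >-> R}).
Hypothesis indepX : mutually_independent X.
Hypothesis indepX' : mutually_independent X'.
Hypothesis indepXX' : independent_sequences X X'.
Hypothesis idX : forall i A, measurable A -> P (X i @^-1` A) = P (X 0%N @^-1` A).
Hypothesis idX' : forall i A, measurable A -> P (X' i @^-1` A) = P (X' 0%N @^-1` A).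
Hypothesis posX : forall i, {ae P, forall w, 0 < X i w}.
Hypothesis posX' : forall i, {ae P, forall w, 0 < X' i w}.

Let p := arrival_probability X X'.
Let mX i : measurable_fun setT (X i). Proof. exact: measurable_funPT. Qed.
Let mX' i : measurable_fun setT (X' i). Proof. exact: measurable_funPT. Qed.

(** The number of events up to time t depends on the tosses, since the duration
    of a step and its outcome come from the same pair. However, the event that it
    equals k only involves the event times from the k-th on, which do not change
    when the first k pairs are reversed, whereas the forward queue becomes the
    backward one. *)
Lemma prob_last_event_reversal q k t j :
  P (last_event X X' k t `&` [set w | embedded_queue X X' q k w = j]) =
  P (last_event X X' k t `&` [set w | queue_bwd q (arrivals X X' k w) = j]).
Proof.
pose x (i : nat) (s : path_space R) : R := (s i).1.
pose x' (i : nat) (s : path_space R) : R := (s i).2.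
pose C := last_event x x' k t `&` [set s | embedded_queue x x' q k s = j].
have mx i : measurable_fun setT (x i).
  by apply: (measurableT_comp measurable_fst); exact: measurable_coord.
have mx' i : measurable_fun setT (x' i).
  by apply: (measurableT_comp measurable_snd); exact: measurable_coord.
have mC : measurable C.
  by apply: measurableI; [exact: measurable_last_event|exact: measurable_embedded_queue].
have eTr n w : (k <= n)%N ->
    event_time x x' n (fun i => pair_at X X' (reversal k i) w) = event_time X X' n w.
  move=> kn; transitivity (event_time (fun i => X (reversal k i)) (fun i => X' (reversal k i)) n w).
    by [].
  apply: (@event_time_perm _ _ (fun i => X i : T -> R) (fun i => X' i : T -> R)).
    by move=> i; exact: reversal_lt.
  exact: can_inj (@reversalK k).
transitivity (P [set w | C (fun i => pair_at X X' i w)]).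
  congr (P _); apply/seteqP; split => w /=.
    by move=> [Lk E]; split => //=; rewrite embedded_queue_fwd -E embedded_queue_fwd.
  by move=> [Lk E]; split => //=; rewrite -E !embedded_queue_fwd.
rewrite (prob_path_reversal indepX indepX' indepXX' idX idX' k)//.
have eQ w : embedded_queue x x' q k (fun i => pair_at X X' (reversal k i) w) =
    queue_bwd q (arrivals X X' k w).
  rewrite embedded_queue_fwd -queue_fwd_rev; congr queue_fwd.
  by rewrite (map_reversal (fun i => X i w < X' i w)).
have eL w : last_event x x' k t (fun i => pair_at X X' (reversal k i) w) <->
    last_event X X' k t w.
  split=> -[Tk Hk]; split; rewrite ?eTr// in Tk *.
    move=> n nt; rewrite leqNgt; apply/negP => kn.
    by have := Hk n; rewrite (eTr _ _ (ltnW kn)) leqNgt kn => /(_ nt).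
  move=> n nt; rewrite leqNgt; apply/negP => kn; rewrite (eTr _ _ (ltnW kn)) in nt.
  by have := Hk n nt; rewrite leqNgt kn.
congr (P _); apply/seteqP; split => w.
  by move=> [/eL Lk /= E]; split => //=; rewrite -eQ.
by move=> [Lk /= E]; split => /=; [exact/eL|rewrite eQ].
Qed.

(** Both variables are positive, so they exceed some e together. *)
Lemma exists_gap : exists2 e : R, 0 < e &
  (0 < P [set w | (e < X 0%N w)%R /\ (e < X' 0%N w)%R])%E.
Proof.
apply: contrapT => H.
pose F n := [set w | n.+1%:R^-1 < X 0%N w] `&` [set w | n.+1%:R^-1 < X' 0%N w].
have mF n : measurable (F n) by apply: measurableI; exact: measurable_RV_gt.
have ndF : nondecreasing_seq F.
  move=> n m nm; apply/subsetPset => w [h h'].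
  have mn : (m.+1%:R^-1 : R) <= n.+1%:R^-1 by rewrite lef_pV2 ?posrE ?ltr0n// ler_nat.
  by split; [exact: le_lt_trans mn h|exact: le_lt_trans mn h'].
have le0 : (P (\bigcup_n F n) <= 0)%E.
  apply: probability_bigcup_le => // n; rewrite leNgt; apply/negP => PF.
  by apply: H; exists n.+1%:R^-1 => //; rewrite invr_gt0 ltr0n.
have [N [mN PN sN]] := posX 0%N; have [N' [mN' PN' sN']] := posX' 0%N.
have mU : measurable (\bigcup_n F n) by exact: bigcupT_measurable.
have cov : setT `<=` (\bigcup_n F n) `|` (N `|` N').
  move=> w _; have [Nw|nNw] := pselect (N w); first by right; left.
  have [Nw'|nNw'] := pselect (N' w); first by right; right.
  left; have X0 : 0 < X 0%N w by apply: contrapT => /sN.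
  have X'0 : 0 < X' 0%N w by apply: contrapT => /sN'.
  have m0 : 0 < Num.min (X 0%N w) (X' 0%N w) by rewrite lt_min X0.
  pose n := Num.bound (Num.min (X 0%N w) (X' 0%N w))^-1.
  have : n.+1%:R^-1 < Num.min (X 0%N w) (X' 0%N w).
    rewrite invf_plt ?posrE ?ltr0n//; apply: (@lt_trans _ _ n%:R); last by rewrite ltr_nat.
    by apply: archi_boundP; rewrite invr_ge0 ltW.
  by rewrite lt_min => /andP[h h']; exists n.
have le1 : (1 <= P ((\bigcup_n F n) `|` (N `|` N')))%E.
  rewrite -(probability_setT P); apply: le_measure; rewrite ?inE//.
  exact: measurableU _ _ mU (measurableU _ _ mN mN').
have : (P ((\bigcup_n F n) `|` (N `|` N')) <= 0)%E.
  apply: (le_trans (probabilityU_le P mU (measurableU _ _ mN mN'))).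
  rewrite -[leRHS]adde0; apply: leeD => //.
  by apply: (le_trans (probabilityU_le P mN mN')); rewrite PN PN' adde0.
by move=> /(le_trans le1); rewrite lee_fin ler10.
Qed.

(** A step lasts more than e with some probability r > 0, and at most t / e
    of the first n steps can do so if the n-th event occurs before t. *)
Lemma prob_no_last_event t : 0 <= t -> P (\bigcap_k ~` last_event X X' k t) = 0%E.
Proof.
move=> t0; have [e e0 Pe] := exists_gap.
have [N [mN PN sN]] : {ae P, forall w, forall i, 0 < X i w /\ 0 < X' i w}.
  by apply: ae_foralln => i; move: (posX i) (posX' i); apply: filterS2 => w.
have mB : measurable (\bigcap_k ~` last_event X X' k t).
  by apply: bigcapT_measurable => k; apply: measurableC; exact: measurable_last_event.
pose c : pred (R * R) := fun z => (e < z.1) && (e < z.2).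
have mc : measurable [set z | c z].
  rewrite (_ : [set z | _] = `]e, +oo[ `*` `]e, +oo[); first exact: measurableX.
  by apply/seteqP; split => z /=; rewrite /c !in_itv/= !andbT; [move=> /andP|move=> [-> ->]].
set r := fine (P (pair_at X X' 0 @^-1` [set z | c z])).
have rE : P [set w | (e < X 0%N w)%R /\ (e < X' 0%N w)%R] = r%:E.
  rewrite /r fineK ?fin_num_measure//; last exact: measurable_preimage_pair_at.
  by congr (P _); apply/seteqP; split => w /=; [move=> [h1 h2]; apply/andP|move=> /andP].
have r0 : 0 < r by rewrite -lte_fin -rE.
have r1 : r <= 1.
  rewrite -lee_fin -rE probability_le1//.
  by apply: measurableI; exact: measurable_RV_gt.
pose K := Num.bound (t / e).
have bound n : (P (\bigcap_k ~` last_event X X' k t) <=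
    (2 ^+ K * (r * 2^-1 + (1 - r) * 1) ^+ n)%:E)%E.
  pose A (s : seq bool) := (count id s <= K)%N.
  have mA : measurable [set w | A (tosses X X' c 0 n w)] by exact: measurable_tosses.
  apply: (@le_trans _ _ (P (N `|` [set w | A (tosses X X' c 0 n w)]))).
    apply: le_measure; rewrite ?inE//; first exact: measurableU.
    move=> w Bw; have [Nw|nNw] := pselect (N w); [by left|right].
    have pos : forall i, 0 < X i w /\ 0 < X' i w by apply: contrapT => /sN.
    have X0 i : 0 <= X i w by have [/ltW] := pos i.
    have X'0 i : 0 <= X' i w by have [_ /ltW] := pos i.
    have Tn : event_time X X' n w <= t.
      rewrite leNgt; apply/negP => tn.
      by have [k Lk] := last_event_exists X0 X'0 t0 tn; exact: (Bw k I Lk).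
    have := le_trans (event_time_ge_count n X0 X'0 (ltW e0)) Tn.
    rewrite mulrC -ler_pdivlMr// => ct.
    rewrite /= /A -(ler_nat R); apply: (le_trans ct); apply: ltW.
    by apply: archi_boundP; rewrite divr_ge0// ltW.
  apply: (le_trans (probabilityU_le P mN mA)); rewrite PN add0e.
  rewrite prob_tosses// lee_fin -/r; have r01 : 0 <= r <= 1 by rewrite ltW.
  have half0 : 0 <= (2^-1 : R) by rewrite invr_ge0.
  have K0 : 0 <= (2 : R) ^+ K by rewrite exprn_ge0.
  apply: (toss_prob_le_genfun r01 half0 ler01 K0).
  move=> s _ As; have -> : \prod_(x <- s) (if x then 2^-1 else 1 : R) = 2^-1 ^+ count id s.
    elim: s {As} => [|[] s IH]; first by rewrite big_nil.
      by rewrite big_cons IH -exprS.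
    by rewrite big_cons IH mul1r.
  rewrite exprVn ler_pdivlMr ?exprn_gt0// mul1r.
  by rewrite ler_weXn2l// ler1n.
have c0 : (2 ^+ K * (r * 2^-1 + (1 - r) * 1) ^+ n)%R @[n --> \oo] --> (2 ^+ K * 0 : R).
  apply: cvgMr; apply: cvg_expr; rewrite ger0_norm; lra.
rewrite mulr0 in c0.
apply/eqP; rewrite -measure_le0.
rewrite -(fineK (fin_num_measure P _ mB)) lee_fin -(cvg_lim _ c0)//.
apply: limr_ge; first exact: cvgP c0.
by near=> n; rewrite -lee_fin fineK ?fin_num_measure.
Unshelve. all: by end_near. Qed.


Let p01 : 0 <= p <= 1. Proof. exact: (p_itv indepX indepX' indepXX' idX idX'). Qed.

Let uncoalesced q m := [set w | queue_bwd q (arrivals X X' m w) != queue_bwd 0 (arrivals X X' m w)].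

Let measurable_uncoalesced q m : measurable (uncoalesced q m).
Proof.
exact: (measurable_arrivals indepX indepX' indepXX' idX idX' m
  (fun e => queue_bwd q e != queue_bwd 0 e)).
Qed.

(* This is p a + (1 - p) / a for a = 2 (1 - p), the expectation of the factor
   contributed by one toss to the bound of [queue_bwd_coalesce]. Of the factors a
   for which it is less than 1, this one avoids a square root. *)
Let c : R := 2 * p * (1 - p) + 1 / 2.

(** Union bound over a geometric series. *)
Lemma prob_uncoalesced_after q n : p < 1 / 2 ->
  (P (\bigcup_m uncoalesced q (n + m)) <= ((2 * (1 - p)) ^+ q * c ^+ n / (1 - c))%:E)%E.
Proof.
move=> p12; have /andP[p0 p1] := p01.
pose a := 2 * (1 - p).
have a1 : 1 <= a by rewrite /a; lra.
have a0 : 0 < a by lra.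
have c0 : 0 <= c by rewrite /c addr_ge0// ?mulr_ge0//; lra.
have c1 : c < 1 by rewrite /c; nra.
have aq : 0 <= a ^+ q by rewrite exprn_ge0// ltW.
have ai0 : 0 <= a^-1 by rewrite invr_ge0 ltW.
have one m : (P (uncoalesced q m) <= (a ^+ q * c ^+ m)%:E)%E.
  rewrite (prob_arrivals indepX indepX' indepXX' idX idX' m
    (fun e => queue_bwd q e != queue_bwd 0 e)) lee_fin.
  have -> : c = p * a + (1 - p) * a^-1.
    by rewrite /c /a; field; lra.
  apply: (toss_prob_le_genfun p01 (ltW a0) ai0 aq) => e _.
  exact: queue_bwd_coalesce.
pose U K := \big[setU/set0]_(m < K) uncoalesced q (n + m).
have mU K : measurable (U K) by apply: bigsetU_measurable => m _; exact: measurable_uncoalesced.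
rewrite -(bigcup_bigsetU_bigcup (fun m => uncoalesced q (n + m))).
apply: (probability_bigcup_le (F := fun K => U K.+1)) => [K||K]; first exact: mU.
  apply/nondecreasing_seqP => K; apply/subsetPset; rewrite {2}/U big_ord_recr/=.
  exact: subsetUl.
move: (K.+1) => {}K.
have : (P (U K) <= (a ^+ q * c ^+ n * ((1 - c ^+ K) / (1 - c)))%:E)%E.
  elim: K => [|K IH]; first by rewrite /U big_ord0 measure0 expr0 subrr mul0r mulr0.
  rewrite /U big_ord_recr/=; apply: (le_trans (probabilityU_le P (mU K) (measurable_uncoalesced _ _))).
  apply: (le_trans (leeD IH (one (n + K)%N))); rewrite -EFinD lee_fin le_eqVlt.
  by apply/orP; left; apply/eqP; rewrite exprD exprS; field; lra.
move=> /le_trans; apply; rewrite lee_fin.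
apply: ler_wpM2l; first exact: mulr_ge0 aq (exprn_ge0 _ c0).
have c10 : 0 < 1 - c by lra.
by rewrite ler_pdivrMr// mulVf ?gt_eqF// gerBl exprn_ge0.
Qed.

(** One more toss changes the innermost argument q of the backward queue to at
    most q + 1, where the queue takes the same value once it has coalesced on
    that range. *)
Lemma queue_bwd_stable q n w : ~ (\bigcup_m uncoalesced q.+1 (n + m)) w ->
  forall m, (n <= m)%N ->
  queue_bwd q (arrivals X X' m w) = queue_bwd 0 (arrivals X X' n w).
Proof.
move=> nD.
have flat m x : (n <= m)%N -> (x <= q.+1)%N ->
    queue_bwd x (arrivals X X' m w) = queue_bwd 0 (arrivals X X' m w).
  move=> nm xq.
  have E : queue_bwd q.+1 (arrivals X X' m w) = queue_bwd 0 (arrivals X X' m w).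
    apply/eqP/negPn/negP => H; apply: nD; exists (m - n)%N => //=.
    by rewrite /uncoalesced /= subnKC.
  by apply/eqP; rewrite eqn_leq -{1}E !queue_bwd_mono.
elim=> [|m IH]; first by rewrite leqn0 => /eqP n0; rewrite flat// n0.
rewrite leq_eqVlt => /orP[/eqP <-|]; first by rewrite flat.
rewrite ltnS => nm; rewrite -IH// arrivalsS /queue_bwd foldr_rcons -!/(queue_bwd _ _).
rewrite [RHS]flat//; apply: flat => //.
by rewrite /queue_step; case: ifP => _ //; lia.
Qed.

Lemma cvg_prob_queue_bwd j : p < 1 / 2 ->
  toss_prob p n (fun e => queue_bwd 0 e == j) @[n --> \oo] -->
  (1 - 2 * p) / (1 - p) * (p / (1 - p)) ^+ j.
Proof.
move=> p12; have /andP[p0 p1] := p01.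
have r1 : 1 / 2 < 1 - p <= 1 by lra.
have r01 : 0 <= 1 - p <= 1 by lra.
rewrite (funext (fun n => toss_prob_queue_bwd_eq p n j)).
have := cvgB (@cvg_hit_ever _ (1 - p) j r01) (@cvg_hit_ever _ (1 - p) j.+1 r01).
rewrite !hit_ever_geom//.
have -> : (1 - (1 - p)) / (1 - p) = p / (1 - p) by congr (_ / _); ring.
have -> : (p / (1 - p)) ^+ j - (p / (1 - p)) ^+ j.+1 =
    (1 - 2 * p) / (1 - p) * (p / (1 - p)) ^+ j by rewrite exprS; field; lra.
exact.
Qed.

Lemma prob_event_time_gt n (e : R) : 0 < e ->
  exists M : R, forall t, M <= t -> (P (~` [set w | (event_time X X' n w <= t)%R]) <= e%:E)%E.
Proof.
move=> e0; apply: contrapT => /forallNP H.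
pose F (m : nat) := ~` [set w | event_time X X' n w <= m%:R].
have mF t : measurable (~` [set w | event_time X X' n w <= t]).
  by apply: measurableC; exact: measurable_event_time_le.
have sub s t : s <= t -> ~` [set w | event_time X X' n w <= t] `<=`
    ~` [set w | event_time X X' n w <= s].
  by move=> st w /= nt ns; apply: nt; exact: le_trans st.
have : (e%:E <= P (\bigcap_m F m))%E.
  apply: probability_bigcap_ge => [m||m]; first exact: mF.
    by move=> m m' mm'; apply/subsetPset; apply: sub; rewrite ler_nat.
  rewrite leNgt; apply/negP => lt1; apply: (H m%:R) => t mt.
  apply: le_trans (ltW lt1); apply: le_measure; rewrite ?inE; [exact: mF|exact: mF|].
  exact: sub.
rewrite (_ : \bigcap_m F m = set0); first by rewrite measure0 lee_fin leNgt e0.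
apply/seteqP; split => w // Fw.
pose m := Num.bound `|event_time X X' n w|.
apply: (Fw m I) => /=; apply: (le_trans (ler_norm _)); apply: ltW.
exact: archi_boundP.
Qed.

(** By reversal the queue length at time t has the law of the backward queue at
    the last event before t. Outside an event of small probability, the backward
    queue no longer changes after the n-th toss and n events occur before t; the
    limit is then the law of the backward queue at n large. *)
Lemma cvg_queue_length q j : p < 1 / 2 ->
  P [set w | queue_length X X' q t w = j] @[t --> +oo] -->
  ((1 - 2 * p) / (1 - p) * (p / (1 - p)) ^+ j)%:E.
Proof.
move=> p12; have /andP[p0 p1] := p01.
set pi := _ * _.
pose none t := \bigcap_k ~` last_event X X' k t.
have mL k t : measurable (last_event X X' k t) by exact: measurable_last_event.
have mQ k i : measurable [set w | embedded_queue X X' q k w = i].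
  exact: measurable_embedded_queue.
have mB q' k i : measurable [set w | queue_bwd q' (arrivals X X' k w) = i].
  rewrite (_ : [set w | _] = [set w | queue_bwd q' (arrivals X X' k w) == i]).
    exact: (measurable_arrivals indepX indepX' indepXX' idX idX' k (fun e => queue_bwd q' e == i)).
  by apply/seteqP; split => w /= /eqP.
have mnone t : measurable (none t).
  by apply: bigcapT_measurable => k; exact: measurableC.
pose fwd t := \bigcup_k (last_event X X' k t `&` [set w | embedded_queue X X' q k w = j]).
pose bwd t := \bigcup_k (last_event X X' k t `&` [set w | queue_bwd q (arrivals X X' k w) = j]).
have mfwd t : measurable (fwd t).
  by apply: bigcupT_measurable => k; exact: measurableI.
have mbwd t : measurable (bwd t).
  by apply: bigcupT_measurable => k; exact: measurableI.
have triv (A : nat -> set T) t : trivIset setT (fun k => last_event X X' k t `&` A k).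
  by move=> k k' _ _ [w [[Lk _] [Lk' _]]]; exact: last_event_inj Lk Lk'.
have fwdE t : 0 <= t -> P [set w | queue_length X X' q t w = j] = P (bwd t).
  move=> t0; transitivity (P (fwd t)).
    rewrite queue_length_eq -/(fwd t) -/(none t).
    have mcst : measurable (none t `&` [set w : T | q = j]).
      have [->|qj] := eqVneq q j.
        by rewrite (_ : [set _ | _] = setT) ?setIT//; apply/seteqP; split.
      rewrite (_ : [set _ | _] = set0) ?setI0//.
      by apply/seteqP; split => // w /= E; move: qj; rewrite E eqxx.
    apply/eqP; rewrite eq_le; apply/andP; split.
      apply: (le_trans (probabilityU_le P (mfwd t) mcst)); rewrite -[leRHS]adde0 leeD2l//.
      rewrite -(prob_no_last_event t0).
      by apply: (probability_le P mcst (mnone t)) => w [].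
    exact: (probability_le P (mfwd t) (measurableU _ _ (mfwd t) mcst) (@subsetUl _ _ _)).
  rewrite measure_bigcup//; last by move=> k _; exact: measurableI.
  rewrite measure_bigcup//; last by move=> k _; exact: measurableI.
  by apply: eq_eseriesr => k _; exact: prob_last_event_reversal.
pose L t := fine (P [set w | queue_length X X' q t w = j]).
have LE t : 0 <= t -> P [set w | queue_length X X' q t w = j] = (L t)%:E.
  by move=> t0; rewrite /L fineK// fwdE// fin_num_measure.
apply: cvg_EFin.
  by near=> t; rewrite LE.
apply/cvgrPdist_le => eps eps0.
have c0 : 0 <= c by rewrite /c addr_ge0// ?mulr_ge0//; lra.
have c1 : c < 1 by rewrite /c; nra.
have e3 : 0 < eps / 3 by lra.
have cV : (2 * (1 - p)) ^+ q.+1 * c ^+ n / (1 - c) @[n --> \oo] --> (0 : R).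
  rewrite -(mul0r (1 - c)^-1) -(mulr0 ((2 * (1 - p)) ^+ q.+1)).
  by apply: cvgMl; apply: cvgMr; apply: cvg_expr; rewrite ger0_norm.
(* n is fixed before t: first let the backward queue settle, then wait for n events. *)
have [n [Vn Bn]] : exists n, (2 * (1 - p)) ^+ q.+1 * c ^+ n / (1 - c) <= eps / 3 /\
    `|pi - toss_prob p n (fun e => queue_bwd 0 e == j)| <= eps / 3.
  have /cvgrPdist_le /(_ _ e3) h1 := cV.
  have /cvgrPdist_le /(_ _ e3) h2 := @cvg_prob_queue_bwd j p12.
  have [n []] := filter_ex (filterI h1 h2).
  rewrite sub0r normrN => h3 h4; exists n; split => //.
  exact: le_trans (ler_norm _) h3.
have [M HM] := prob_event_time_gt n e3.
near=> t.
have t0 : 0 <= t by near: t; apply: nbhs_pinfty_ge; exact: num_real.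
have Mt : M <= t by near: t; apply: nbhs_pinfty_ge; exact: num_real.
pose V := \bigcup_m uncoalesced q.+1 (n + m).
pose U := ~` [set w | event_time X X' n w <= t].
pose B := [set w | queue_bwd 0 (arrivals X X' n w) = j].
have mV : measurable V by apply: bigcupT_measurable => m; exact: measurable_uncoalesced.
have mU : measurable U by apply: measurableC; exact: measurable_event_time_le.
have PV : (P V <= (eps / 3)%:E)%E.
  by apply: (le_trans (prob_uncoalesced_after q.+1 n p12)); rewrite lee_fin.
have PU : (P U <= (eps / 3)%:E)%E := HM t Mt.
have PB : P B = (toss_prob p n (fun e => queue_bwd 0 e == j))%:E.
  rewrite -(prob_arrivals indepX indepX' indepXX' idX idX').
  by congr (P _); apply/seteqP; split => w /= /eqP.
have mVU : measurable (V `|` U) by exact: measurableU.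
have PVU : (P (V `|` U) <= (eps / 3 + eps / 3)%:E)%E.
  by apply: (le_trans (probabilityU_le P mV mU)); rewrite EFinD leeD.
have PL : P (bwd t) = (L t)%:E by rewrite -fwdE// LE.
have late k w : ~ U w -> last_event X X' k t w -> (n <= k)%N.
  by move=> /contrapT Tn [_ Hk]; exact: Hk.
have sub1 : bwd t `<=` B `|` (V `|` U).
  move=> w [k _ [Lk /= E]]; have [Vw|nVw] := pselect (V w); first by right; left.
  have [Uw|nUw] := pselect (U w); first by right; right.
  by left; rewrite /B /= -E (queue_bwd_stable nVw (late _ _ nUw Lk)).
have sub2 : B `<=` bwd t `|` ((V `|` U) `|` none t).
  move=> w E; have [Vw|nVw] := pselect (V w); first by right; left; left.
  have [Uw|nUw] := pselect (U w); first by right; left; right.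
  have [[k Lk]|/forallNP nL] := pselect (exists k, last_event X X' k t w).
    by left; exists k => //; split => //=; rewrite (queue_bwd_stable nVw (late _ _ nUw Lk)).
  by right; right => k _; exact: nL.
have le1 : L t <= toss_prob p n (fun e => queue_bwd 0 e == j) + (eps / 3 + eps / 3).
  rewrite -lee_fin EFinD -PL -PB.
  apply: (@le_trans _ _ (P (B `|` (V `|` U)))).
    by apply: le_measure; rewrite ?inE//; apply: measurableU => //; exact: mB.
  apply: (le_trans (probabilityU_le P (mB 0%N n j) mVU)).
  by rewrite leeD2l.
have le2 : toss_prob p n (fun e => queue_bwd 0 e == j) <= L t + (eps / 3 + eps / 3).
  rewrite -lee_fin EFinD -PL -PB.
  have mVUn : measurable ((V `|` U) `|` none t) by exact: measurableU.
  apply: (@le_trans _ _ (P (bwd t `|` ((V `|` U) `|` none t)))).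
    by apply: le_measure; rewrite ?inE//; [exact: mB|exact: measurableU].
  apply: (le_trans (probabilityU_le P (mbwd t) mVUn)); rewrite leeD2l//.
  apply: (le_trans (probabilityU_le P mVU (mnone t))).
  by rewrite (prob_no_last_event t0) adde0.
suff : `|pi - L t| <= eps by [].
move: Bn le1 le2; rewrite !ler_norml; move: (toss_prob _ _ _) (L t) => x y /andP[b1 b2] h1 h2.
by apply/andP; split; lra.
Unshelve. all: by end_near. Qed.

End Equilibrium.

(** * Conclusion *)
Lemma identically_distributed (R : realType) d (T : measurableType d)
    (P : probability T R) (X : nat -> {RV P >-> R}) (a l : R) :
  0 < l -> (forall i, is_mittag_leffler_RV (X i) a l) ->
  forall i A, measurable A -> P (X i @^-1` A) = P (X 0%N @^-1` A).
Proof.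
move=> l0 HX i A mA; rewrite (law_mittag_leffler_scale l0 l0 (HX i) (HX 0%N) mA).
by congr (P _); apply/seteqP; split => w /=; rewrite divff ?gt_eqF// mul1r.
Qed.

Theorem proposition3p5 (R : realType) (alpha beta : R)
    (halpha : 0 < alpha < 1) (hbeta : 0 < beta < 1) :
  exists rho : R, 0 < rho /\
    forall (lambda mu : R), 0 < lambda -> 0 < mu ->
    forall (d : measure_display) (T : measurableType d) (P : probability T R)
      (X X' : nat -> {RV P >-> R}),
    renewal_queue_input alpha beta lambda mu X X' ->
    [/\ transient P (embedded_queue X X') <-> rho < lambda / mu,
        lambda / mu < rho ->
          forall q0 j : nat,
          let p := arrival_probability X X' in
          P [set w | queue_length X X' q0 t w = j] @[t --> +oo] -->
            ((1 - 2 * p) / (1 - p) * (p / (1 - p)) ^+ j)%:E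
      & lambda / mu = rho -> null_recurrent P (embedded_queue X X')].
Proof.
have [rho [rho0 Hrho]] := critical_ratio halpha hbeta.
exists rho; split => // lambda mu l0 m0 d T P X X' input.
have [peq plt pgt] := Hrho _ _ l0 m0 _ _ _ _ _ input.
have [[iX HX] [iX' HX'] iXX'] := input.
have idX := identically_distributed l0 HX.
have idX' := identically_distributed m0 HX'.
split.
- split=> [tr|/pgt /andP[p12 _]]; last exact: transient_embedded.
  rewrite ltNge; apply/negP => le; apply: (recurrent_embedded iX iX' iXX' idX idX') tr.
  move: le; rewrite le_eqVlt => /orP[/eqP /peq ->//|/plt /andP[_ /ltW]//].
- move=> /plt /andP[_ p12] q0 j p; apply: cvg_queue_length => //.
    by move=> i; have [] := HX i.
  by move=> i; have [] := HX' i.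
- by move=> /peq p12; exact: null_recurrent_embedded.
Qed.
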